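(* Let $\mathcal{H}$ be a real Hilbert space, $r$ a strictly positive integer, $z\in\mathcal{H}$, $f\in\Gamma_0(\mathcal{H})$, and $\ell\colon\mathcal{H}\to\mathbb{R}$ differentiable convex with $\mu$-Lipschitzian gradient for some $\mu\in[0,+\infty[$. For every $k\in\{1,\ldots,r\}$ let $\mathcal{G}_k,\mathcal{K}_k$ be real Hilbert spaces, $g_k\in\Gamma_0(\mathcal{G}_k)$, $h_k\in\Gamma_0(\mathcal{K}_k)$, and $L_k\colon\mathcal{H}\to\mathcal{G}_k$, $M_k\colon\mathcal{H}\to\mathcal{K}_k$ bounded linear operators. Assume $\beta=\mu+\sqrt{\sum_{k=1}^r\|L_k\|^2+\max_{1\le k\le r}(\|L_k\|^2+\|M_k\|^2)}>0$, that for every $k$, $0\in\operatorname{sri}\big(\operatorname{dom}(g_k\circ L_k)^*-M_k^*(\operatorname{dom}h_k^* )\big)$ and $0\in\operatorname{sri}(\operatorname{ran}M_k-\operatorname{dom}h_k)$, and that $z\in\operatorname{ran}\Big(\partial f+\sum_{k=1}^r\big((L_k^*\circ(\partial g_k)\circ L_k)\,\square\,(M_k^*\circ(\partial h_k)\circ M_k)\big)+\nabla\ell\Big)$. Consider the primal problem (P) minimize over $x\in\mathcal{H}$: $f(x)+\sum_{k=1}^r\big((g_k\circ L_k)\,\square\,(h_k\circ M_k)\big)(x)+\ell(x)-\langle x,z\rangle$, and the dual problem (D) minimize over $v_1\in\mathcal{G}_1,\ldots,v_r\in\mathcal{G}_r$: $(f^*\,\square\,\ell^* )\big(z-\sum_{k=1}^rL_k^*v_k\big)+\sum_{k=1}^r\big(g_k^*(v_k)+(M_k^*\triangleright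 h_k^* )(L_k^*v_k)\big)$. Let $x_0,y_{1,0},\ldots,y_{r,0}\in\mathcal{H}$, $v_{k,0}\in\mathcal{G}_k$, $w_{k,0}\in\mathcal{K}_k$, let $\varepsilon\in\left]0,1/(\beta+1)\right[$, let $(\gamma_n)_{n\in\mathbb{N}}$ be a sequence in $[\varepsilon,(1-\varepsilon)/\beta]$, and for $n=0,1,\ldots$ set $s_{1,1,n}\approx x_n-\gamma_n\big(\nabla\ell(x_n)+\sum_{k=1}^rL_k^*v_{k,n}\big)$, $p_{1,1,n}\approx\operatorname{prox}_{\gamma_nf}(s_{1,1,n}+\gamma_nz)$, and for $k=1,\ldots,r$: $p_{1,k+1,n}\approx y_{k,n}+\gamma_n(L_k^*v_{k,n}-M_k^*w_{k,n})$, $s_{2,k,n}\approx v_{k,n}+\gamma_nL_k(x_n-y_{k,n})$, $p_{2,k,n}\approx s_{2,k,n}-\gamma_n\operatorname{prox}_{\gamma_n^{-1}g_k}(\gamma_n^{-1}s_{2,k,n})$, $q_{2,k,n}\approx p_{2,k,n}+\gamma_nL_k(p_{1,1,n}-p_{1,k+1,n})$, $v_{k,n+1}=v_{k,n}-s_{2,k,n}+q_{2,k,n}$, $s_{2,k+r,n}\approx w_{k,n}+\gamma_nM_ky_{k,n}$, $p_{2,k+r,n}\approx s_{2,k+r,n}-\gamma_n\operatorname{prox}_{\gamma_n^{-1}h_k}(\gamma_n^{-1}s_{2,k+r,n})$, $q_{1,k+1,n}\approx p_{1,k+1,n}+\gamma_n(L_k^*p_{2,k,n}-M_k^*p_{2,k+r,n})$,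 $q_{2,k+r,n}\approx p_{2,k+r,n}+\gamma_nM_kp_{1,k+1,n}$, $w_{k,n+1}=w_{k,n}-s_{2,k+r,n}+q_{2,k+r,n}$; then $q_{1,1,n}\approx p_{1,1,n}-\gamma_n\big(\nabla\ell(p_{1,1,n})+\sum_{k=1}^rL_k^*p_{2,k,n}\big)$, $x_{n+1}=x_n-s_{1,1,n}+q_{1,1,n}$, and for $k=1,\ldots,r$: $y_{k,n+1}=y_{k,n}-p_{1,k+1,n}+q_{1,k+1,n}$. Then there exist a solution $\overline{x}$ to (P) and a solution $(\overline{v_1},\ldots,\overline{v_r})$ to (D) such that: (i) $x_n\rightharpoonup\overline{x}$ and $v_{k,n}\rightharpoonup\overline{v_k}$ for every $k$; (ii) if $f$ or $\ell$ is uniformly convex at $\overline{x}$, then $x_n\to\overline{x}$; (iii) if, for some $k\in\{1,\ldots,r\}$, $g_k^*$ is uniformly convex at $\overline{v_k}$, then $v_{k,n}\to\overline{v_k}$.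
   Context: $\Gamma_0(\mathcal{X})$ is the class of lower semicontinuous convex functions $\mathcal{X}\to\left]-\infty,+\infty\right]$ with nonempty domain; $\varphi^*$ is the Fenchel conjugate, $\partial\varphi$ the subdifferential, and $\operatorname{prox}_\varphi x$ the unique minimizer of $\varphi+\tfrac12\|x-\cdot\|^2$. For a convex set $S$, $\operatorname{sri}S$ is the set of $x\in S$ such that the cone generated by $-x+S$ is a closed vector subspace. Functions: $(\varphi_1\,\square\,\varphi_2)(x)=\inf_y(\varphi_1(x-y)+\varphi_2(y))$ (infimal convolution) and $(L\triangleright\varphi)(y)=\inf\{\varphi(x):Lx=y\}$ (infimal postcomposition). Operators: $T^{-1}$ is the inverse, $\operatorname{ran}$ the range, $T_1\,\square\,T_2=(T_1^{-1}+T_2^{-1})^{-1}$. $\rightharpoonup$ and $\to$ denote weak and strong convergence. Error tolerance: ''$a_n\approx b_n$'' means $\sum_n\|a_n-b_n\|<+\infty$, i.e., each such quantity is computed with summable errors. A function $\varphi$ is uniformly convex at $x\in\operatorname{dom}\varphi$ if there is an increasing $\phi\colon[0,+\infty[\to[0,+\infty]$ vanishing only at $0$ with $\varphi(\alpha x+(1-\alpha)y)+\alpha(1-\alpha)\phi(\|x-y\|)\le\alpha\varphi(x)+(1-\alpha)\varphi(y)$ for all $y\in\operatorname{dom}\varphi$ and $\alpha\in\left]0,1\right[$. *)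

(* Defs.v *)
From HB Require Import structures.
From mathcomp Require Import all_boot all_order all_algebra.
From mathcomp Require Import all_classical all_reals.
From mathcomp Require Import ereal topology normedtype sequences.
From Stdlib Require Import ClassicalEpsilon.

Set Implicit Arguments.
Unset Strict Implicit.
Unset Printing Implicit Defensive.

Import Order.TTheory GRing.Theory Num.Theory.
Import numFieldNormedType.Exports.
Local Open Scope classical_set_scope.
Local Open Scope ring_scope.

Section HilbertDef.
Variable R : realType.

Definition is_inner_product (V : lmodType R) (ip : V -> V -> R) :=
  [/\ (forall x y, ip x y = ip y x),
      (forall a x y z, ip (a *: x + y) z = a * ip x z + ip y z),
      (forall x, 0 <= ip x x) &
      (forall x, ip x x = 0 -> x = 0)].

Definition ip_norm (V : lmodType R) (ip : V -> V -> R) (x : V) : R :=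
  Num.sqrt (ip x x).

Definition ip_complete (V : lmodType R) (ip : V -> V -> R) :=
  forall u : nat -> V,
    (forall e : R, 0 < e -> exists N, forall m n, (N <= m)%N -> (N <= n)%N ->
        ip_norm ip (u m - u n) < e) ->
    exists l : V, (fun n => ip_norm ip (u n - l)) @ \oo --> (0 : R).

Record hilbert := Hilbert {
  hsort :> lmodType R;
  hinner : hsort -> hsort -> R;
  hinnerP : is_inner_product hinner;
  hcompleteP : ip_complete hinner }.

End HilbertDef.

Section HilbertTheory.
Variable R : realType.
Local Open Scope ring_scope.

Definition inner (H : hilbert R) (x y : H) : R := hinner x y.
Definition hnorm (H : hilbert R) (x : H) : R := Num.sqrt (inner x x).

Definition strong_cvg (H : hilbert R) (u : nat -> H) (l : H) :=
  (fun n => hnorm (u n - l)) @ \oo --> (0 : R).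
Definition weak_cvg (H : hilbert R) (u : nat -> H) (l : H) :=
  forall y : H, (fun n => inner (u n) y) @ \oo --> inner l y.

Definition bounded_linear (H G : hilbert R) (L : H -> G) :=
  (forall (a : R) (x y : H), L (a *: x + y) = a *: L x + L y) /\
  exists c : R, forall x, hnorm (L x) <= c * hnorm x.

Definition is_adjoint (H G : hilbert R) (L : H -> G) (Ls : G -> H) :=
  forall x y, inner (L x) y = inner x (Ls y).

Definition opnorm (H G : hilbert R) (L : H -> G) : R :=
  sup [set hnorm (L x) | x in [set x : H | hnorm x <= 1]].

Local Open Scope ereal_scope.

Definition dom (H : hilbert R) (f : H -> \bar R) : set H :=
  [set x | f x < +oo].

Definition proper_fun (H : hilbert R) (f : H -> \bar R) :=
  (forall x, -oo < f x) /\ exists x, f x < +oo.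

Definition lsc (H : hilbert R) (f : H -> \bar R) :=
  forall (x : H) (t : R), t%:E < f x ->
    exists2 d : R, (0 < d)%R &
      forall y, (hnorm (y - x) < d)%R -> t%:E < f y.

Definition convex_fun (H : hilbert R) (f : H -> \bar R) :=
  forall (a : R) (x y : H), (0 < a < 1)%R ->
    f (a *: x + (1 - a) *: y)%R <= a%:E * f x + (1 - a)%:E * f y.

Definition Gamma0 (H : hilbert R) (f : H -> \bar R) :=
  [/\ proper_fun f, lsc f & convex_fun f].

Definition fconj (H : hilbert R) (f : H -> \bar R) : H -> \bar R :=
  fun u => ereal_sup [set (inner x u)%:E - f x | x in [set: H]].

Definition subdiff (H : hilbert R) (f : H -> \bar R) : H -> set H :=
  fun x => [set u | f x < +oo /\
     forall y, (inner (y - x)%R u)%:E + f x <= f y].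

Definition is_prox (H : hilbert R) (f : H -> \bar R) (x p : H) :=
  forall y, f p + (hnorm (x - p)%R ^+ 2 / 2)%:E
            <= f y + (hnorm (x - y)%R ^+ 2 / 2)%:E.

Definition prox (H : hilbert R) (f : H -> \bar R) (x : H) : H :=
  epsilon (inhabits (0%R : H)) (is_prox f x).

Definition fscale (H : hilbert R) (c : R) (f : H -> \bar R) : H -> \bar R :=
  fun x => c%:E * f x.

Definition infconv (H : hilbert R) (f1 f2 : H -> \bar R) : H -> \bar R :=
  fun x => ereal_inf [set f1 (x - y)%R + f2 y | y in [set: H]].

Definition infpost (H G : hilbert R) (L : H -> G) (f : H -> \bar R) : G -> \bar R :=
  fun y => ereal_inf [set f x | x in [set x : H | L x = y]].

Definition unif_convex_at (H : hilbert R) (f : H -> \bar R) (x : H) :=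
  f x < +oo /\
  exists phi : R -> \bar R,
    [/\ (forall s t : R, (0 <= s)%R -> (s <= t)%R -> phi s <= phi t),
        (forall t : R, (0 <= t)%R -> 0 <= phi t),
        (forall t : R, (0 <= t)%R -> phi t = 0 -> t = 0%R),
        phi 0%R = 0 &
        forall (y : H) (a : R), f y < +oo -> (0 < a < 1)%R ->
          f (a *: x + (1 - a) *: y)%R + (a * (1 - a))%:E * phi (hnorm (x - y)%R)
            <= a%:E * f x + (1 - a)%:E * f y].

Local Close Scope ereal_scope.

Definition is_gradient (H : hilbert R) (l : H -> R) (gl : H -> H) :=
  forall x (e : R), 0 < e -> exists2 d : R, 0 < d &
    forall h, hnorm h < d ->
      `| l (x + h) - l x - inner h (gl x) | <= e * hnorm h.

Definition lipschitz_with (H G : hilbert R) (mu : R) (T : H -> G) :=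
  forall x y, hnorm (T x - T y) <= mu * hnorm (x - y).

Definition op_add (H : hilbert R) (A B : H -> set H) : H -> set H :=
  fun x => [set a + b | a in A x & b in B x].
Definition op_zero (H : hilbert R) : H -> set H := fun _ => [set 0].
Definition op_inv (H : hilbert R) (A : H -> set H) : H -> set H :=
  fun u => [set x | A x u].
Definition op_parsum (H : hilbert R) (A B : H -> set H) : H -> set H :=
  op_inv (op_add (op_inv A) (op_inv B)).
Definition op_comp (H G : hilbert R) (L : H -> G) (Ls : G -> H)
  (A : G -> set G) : H -> set H := fun x => Ls @` A (L x).
Definition op_single (H : hilbert R) (T : H -> H) : H -> set H :=
  fun x => [set T x].
Definition ran (H : hilbert R) (A : H -> set H) : set H :=
  [set u | exists x, A x u].

Definition set_sub (H : hilbert R) (A B : set H) : set H :=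
  [set a - b | a in A & b in B].
Definition cone_gen (H : hilbert R) (C : set H) : set H :=
  [set l *: c | l in [set l : R | 0 < l] & c in C].
Definition closed_subspace (H : hilbert R) (V : set H) :=
  [/\ V 0, (forall x y, V x -> V y -> V (x + y)),
      (forall (a : R) x, V x -> V (a *: x)) &
      (forall (u : nat -> H) l, (forall n, V (u n)) -> strong_cvg u l -> V l)].
Definition sri (H : hilbert R) (S : set H) : set H :=
  [set x | S x /\ closed_subspace (cone_gen [set - x + s | s in S])].

Definition approx (H : hilbert R) (a b : nat -> H) :=
  (\sum_(n <oo) (hnorm (a n - b n))%:E < +oo)%E.

End HilbertTheory.

(* Main.v *)
(* Introduce the auxiliary variables y_k and dual variables v_k, w_k.  The
   inclusions L_k^* v_k = M_k^* w_k, v_k in dg_k(L_k (x - y_k)),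
   w_k in dh_k(M_k y_k), z - sum_k L_k^* v_k - grad l(x) in df(x) say that
   (x, y, v, w) is a zero of A + Q in the product Hilbert space, where
   A = (-z + df) x 0 x (dg_k)^-1 x (dh_k)^-1 is monotone and Q is monotone and
   beta-Lipschitz (a gradient plus a skew operator).  The algorithm is Tseng's
   forward-backward-forward method for A + Q with summable errors: its iterates
   are quasi-Fejer monotone with respect to the zeros, and every weak cluster
   point is a zero, so they converge weakly.  Weak compactness is obtained from
   ultrafilters on nat and the Riesz representation theorem.  Zeros solve (P) and
   (D) by the Fenchel-Young equality. *)

Require Import Defs.
From HB Require Import structures.
From mathcomp Require Import all_boot all_order all_algebra.
From mathcomp Require Import all_classical all_reals.
From mathcomp Require Import ereal topology normedtype sequences.
From mathcomp Require Import ring lra.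
From Stdlib Require Import ClassicalEpsilon.

Set Implicit Arguments.
Unset Strict Implicit.
Unset Printing Implicit Defensive.

Import Order.TTheory GRing.Theory Num.Theory.
Import numFieldNormedType.Exports.
Local Open Scope classical_set_scope.
Local Open Scope ring_scope.

(** The [y_k] undo the parallel sum: [u] is a value at [x] of the parallel sum of two operators
    exactly when, for some [y], it is a value of the first at [x - y] and of the second at [y]. Each
    function then sits in its own block, and only individual proximal maps, [L_k], [M_k] and their
    adjoints occur. Maximality of [A] enters as a resolvent defined everywhere, available blockwise
    because proximal points exist; evaluating it at one well-chosen point shows that weak limits are
    zeros. Proximal points come from a strongly convex minimisation whose minimising sequences are
    Cauchy, so the Riesz theorem can be derived from them without circularity. Strong convergence
    rests on one scalar: the pairing of [pt n - X] with [a n + Q (pt n)] tends to 0 and is a sum of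
    nonnegative terms attached to [f], [l], the [g_k] and the [h_k]. Each term therefore tends to 0,
    and a uniformly convex one controls the distance to the solution. *)

Section InnerProduct.
Variables (R : realType) (H : hilbert R).
Implicit Types (x y z : H) (a : R).

Lemma innerC x y : inner x y = inner y x.
Proof. by case: (hinnerP H). Qed.

Lemma innerDl x y z : inner (x + y) z = inner x z + inner y z.
Proof.
by case: (hinnerP H) => _ lin _ _; rewrite -[x]scale1r /inner lin mul1r scale1r.
Qed.

Lemma inner0l z : inner 0 z = 0.
Proof. by apply: (addrI (inner 0 z)); rewrite -innerDl !addr0. Qed.

Lemma innerZl a x z : inner (a *: x) z = a * inner x z.
Proof.
case: (hinnerP H) => _ lin _ _.
by rewrite -[a *: x]addr0 /inner lin -[X in _ + X]/(inner 0 z) inner0l addr0.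
Qed.

Lemma innerNl x z : inner (- x) z = - inner x z.
Proof. by rewrite -scaleN1r innerZl mulN1r. Qed.

Lemma innerBl x y z : inner (x - y) z = inner x z - inner y z.
Proof. by rewrite innerDl innerNl. Qed.

Lemma inner0r z : inner z 0 = 0. Proof. by rewrite innerC inner0l. Qed.

Lemma innerDr x y z : inner z (x + y) = inner z x + inner z y.
Proof. by rewrite innerC innerDl !(innerC _ z). Qed.

Lemma innerZr a x z : inner z (a *: x) = a * inner z x.
Proof. by rewrite innerC innerZl innerC. Qed.

Lemma innerNr x z : inner z (- x) = - inner z x.
Proof. by rewrite innerC innerNl innerC. Qed.

Lemma innerBr x y z : inner z (x - y) = inner z x - inner z y.
Proof. by rewrite innerDr innerNr. Qed.

Lemma inner_suml (I : finType) (F : I -> H) z :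
  inner (\sum_i F i) z = \sum_i inner (F i) z.
Proof.
by elim/big_rec2: _ => [|i a b _ <-]; rewrite ?inner0l ?innerDl.
Qed.

Lemma inner_sumr (I : finType) (F : I -> H) z :
  inner z (\sum_i F i) = \sum_i inner z (F i).
Proof. by rewrite innerC inner_suml; under eq_bigr do rewrite innerC. Qed.

Lemma inner_ge0 x : 0 <= inner x x. Proof. by case: (hinnerP H). Qed.

Lemma inner_eq0 x : inner x x = 0 -> x = 0.
Proof. by case: (hinnerP H) => _ _ _; apply. Qed.

(** Pairing with an arbitrary vector turns a vector identity into a scalar one, which [ring] or
    [field] can settle. *)
Lemma inner_ext x y : (forall z, inner z x = inner z y) -> x = y.
Proof.
move=> e; apply/eqP; rewrite -subr_eq0; apply/eqP/inner_eq0.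
by rewrite innerBr e subrr.
Qed.

Lemma hnorm_ge0 x : 0 <= hnorm x. Proof. exact: sqrtr_ge0. Qed.

Lemma hnorm_sq x : hnorm x ^+ 2 = inner x x.
Proof. by rewrite sqr_sqrtr // inner_ge0. Qed.

Lemma hnorm0 : hnorm (0 : H) = 0. Proof. by rewrite /hnorm inner0l sqrtr0. Qed.

Lemma hnorm_eq0 x : hnorm x = 0 -> x = 0.
Proof. by move=> x0; apply: inner_eq0; rewrite -hnorm_sq x0 expr0n. Qed.

Lemma hnormN x : hnorm (- x) = hnorm x.
Proof. by rewrite /hnorm innerNl innerNr opprK. Qed.

Lemma hnormZ a x : hnorm (a *: x) = `|a| * hnorm x.
Proof.
rewrite /hnorm innerZl innerZr mulrA -expr2 sqrtrM ?sqr_ge0 //.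
by rewrite sqrtr_sqr.
Qed.

Lemma hdistC x y : hnorm (x - y) = hnorm (y - x).
Proof. by rewrite -hnormN opprB. Qed.

(** Cauchy-Schwarz, by expanding the square of [hnorm y *: x - hnorm x *: y], which has the factor
    [hnorm x * hnorm y - inner x y]. *)
Lemma inner_le x y : inner x y <= hnorm x * hnorm y.
Proof.
have [x0|xN0] := eqVneq (hnorm x) 0.
  by rewrite x0 (hnorm_eq0 x0) inner0l mul0r.
have [y0|yN0] := eqVneq (hnorm y) 0.
  by rewrite y0 (hnorm_eq0 y0) inner0r mulr0.
have xp : 0 < hnorm x by rewrite lt_def xN0 hnorm_ge0.
have yp : 0 < hnorm y by rewrite lt_def yN0 hnorm_ge0.
have := inner_ge0 (hnorm y *: x - hnorm x *: y).
rewrite innerBl !innerBr !innerZl !innerZr (innerC y x) -!hnorm_sq => h.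
have : 0 <= 2 * (hnorm x * hnorm y) * (hnorm x * hnorm y - inner x y) by lra.
by rewrite pmulr_rge0 ?subr_ge0 // !mulr_gt0.
Qed.

Lemma inner_abs_le x y : `|inner x y| <= hnorm x * hnorm y.
Proof.
by rewrite ler_norml inner_le andbT lerNl -innerNl -(hnormN x) inner_le.
Qed.

Lemma hnormD_le x y : hnorm (x + y) <= hnorm x + hnorm y.
Proof.
rewrite -(ler_pXn2r (_ : 0 < 2)%N) ?nnegrE ?addr_ge0 ?hnorm_ge0 //.
rewrite hnorm_sq innerDl !innerDr (innerC y x) -!hnorm_sq sqrrD.
have := inner_le x y; lra.
Qed.

Lemma hnormB_le x y : hnorm (x - y) <= hnorm x + hnorm y.
Proof. by rewrite -(hnormN y) hnormD_le. Qed.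

Lemma hdist_triangle x y z : hnorm (x - z) <= hnorm (x - y) + hnorm (y - z).
Proof. by rewrite -{1}[x](subrK y) -addrA hnormD_le. Qed.

Lemma hnormBB x y : `|hnorm x - hnorm y| <= hnorm (x - y).
Proof.
rewrite ler_norml; have := hnormD_le (x - y) y; have := hnormD_le (y - x) x.
by rewrite !subrK (hdistC y x) => *; apply/andP; split; lra.
Qed.

Lemma hnormB_sq x y :
  hnorm (x - y) ^+ 2 = hnorm x ^+ 2 - 2 * inner x y + hnorm y ^+ 2.
Proof. by rewrite !hnorm_sq innerBl !innerBr (innerC y x); ring. Qed.

(** The exact convexity defect of the squared norm; at the midpoint it makes minimising sequences of
    a proximal problem Cauchy. *)
Lemma hnorm_sq_convex a x y :
  hnorm (a *: x + (1 - a) *: y) ^+ 2 =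
  a * hnorm x ^+ 2 + (1 - a) * hnorm y ^+ 2 - a * (1 - a) * hnorm (x - y) ^+ 2.
Proof.
rewrite !hnorm_sq !innerDl !innerDr !innerZl !innerZr !innerNl !innerNr.
by rewrite (innerC y x); ring.
Qed.

Lemma hcomplete (u : nat -> H) :
  (forall e : R, 0 < e -> exists N, forall m n, (N <= m)%N -> (N <= n)%N ->
     hnorm (u m - u n) < e) ->
  exists l, strong_cvg u l.
Proof. exact: hcompleteP. Qed.

End InnerProduct.

(** * Bounded linear maps and the operator norm *)

Section LinearMaps.
Variables (R : realType) (H G : hilbert R) (L : H -> G).
Hypothesis bL : bounded_linear L.

Lemma blinD x y : L (x + y) = L x + L y.
Proof. by case: bL => lin _; rewrite -[x]scale1r lin !scale1r. Qed.

Lemma blin0 : L 0 = 0.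
Proof. by apply: (addrI (L 0)); rewrite -blinD !addr0. Qed.

Lemma blinZ a x : L (a *: x) = a *: L x.
Proof. by case: bL => lin _; rewrite -[a *: x]addr0 lin blin0 addr0. Qed.

Lemma blinN x : L (- x) = - L x.
Proof. by rewrite -scaleN1r blinZ scaleN1r. Qed.

Lemma blinB x y : L (x - y) = L x - L y.
Proof. by rewrite blinD blinN. Qed.

Lemma has_sup_opnorm :
  has_sup [set hnorm (L x) | x in [set x : H | hnorm x <= 1]].
Proof.
split; first by exists (hnorm (L 0)); exists 0 => //=; rewrite hnorm0.
case: bL => _ [c Lc]; exists `|c| => _ [x /= x1 <-].
rewrite (le_trans (Lc x)) // (le_trans (ler_norm _)) // normrM.
by rewrite ler_piMr // ger0_norm ?hnorm_ge0.
Qed.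

Lemma opnorm_ge0 : 0 <= opnorm L.
Proof.
apply: (le_trans (hnorm_ge0 (L 0))); apply: ub_le_sup.
  by case: has_sup_opnorm.
by exists 0 => //=; rewrite hnorm0.
Qed.

Lemma opnormP x : hnorm (L x) <= opnorm L * hnorm x.
Proof.
have [x0|xN0] := eqVneq (hnorm x) 0.
  by rewrite x0 (hnorm_eq0 x0) blin0 hnorm0 mulr0.
have xp : 0 < hnorm x by rewrite lt_def xN0 hnorm_ge0.
rewrite -ler_pdivrMr // mulrC -[X in X * _]ger0_norm ?invr_ge0 ?hnorm_ge0 //.
rewrite -hnormZ -blinZ; apply: ub_le_sup; first by case: has_sup_opnorm.
exists ((hnorm x)^-1 *: x) => //=; rewrite hnormZ ger0_norm ?invr_ge0 ?hnorm_ge0 //.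
by rewrite mulVf.
Qed.

End LinearMaps.

(** * Proximal points and weak limits *)

(** The limit as [a] tends to 0: if [v < u], a small [a] makes [a * c] at most half the gap. It
    extracts first-order inequalities from convex combinations. *)
Lemma ler_addM_small (R : realType) (u v c : R) :
  (forall a, 0 < a < 1 -> u <= v + a * c) -> u <= v.
Proof.
move=> h; rewrite leNgt; apply/negP => vu.
have [c0|c0] := leP c 0.
  by have := h 2^-1; rewrite invr_gt0 invf_lt1 // ltr1n ltr0n => /(_ isT); nra.
pose a := Num.min 2^-1 ((u - v) / (2 * c)).
have a0 : 0 < a < 1.
  rewrite lt_min gt_min invr_gt0 invf_lt1 // ltr1n ltr0n /= andbT.
  by rewrite divr_gt0 ?subr_gt0 ?mulr_gt0.
have : a * c <= (u - v) / (2 * c) * c.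
  by rewrite ler_pM2r // ge_min lexx orbT.
have -> : (u - v) / (2 * c) * c = (u - v) / 2 by field; rewrite gt_eqF.
have := h a a0; lra.
Qed.

Lemma strong_cvg_near (R : realType) (H : hilbert R) (u : nat -> H) p (e : R) :
  strong_cvg u p -> 0 < e -> \forall n \near \oo, hnorm (u n - p) < e.
Proof.
move=> /cvgrPdist_lt up /up; apply: filterS => n.
by rewrite sub0r normrN ger0_norm ?hnorm_ge0.
Qed.

Lemma strong_cvg_hdist (R : realType) (H : hilbert R) (x : H) (u : nat -> H) p :
  strong_cvg u p -> (fun n => hnorm (x - u n)) @ \oo --> hnorm (x - p).
Proof.
move=> up; apply/cvgrPdist_lt => e e0; have := strong_cvg_near up e0.
apply: filterS => n; apply: le_lt_trans; apply: (le_trans (hnormBB _ _)).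
by rewrite opprB addrC addrA subrK.
Qed.

Section Prox.
Variables (R : realType) (H : hilbert R).
Implicit Types (F : H -> \bar R) (x y p : H).

Lemma proper_funP F x : proper_fun F -> F x = +oo%E \/ exists s, F x = s%:E.
Proof.
by move=> [+ _] => /(_ x); case: (F x) => [s| |] //; [right; exists s|left].
Qed.

Lemma proper_fun_fin F x : proper_fun F -> (F x < +oo)%E -> exists s, F x = s%:E.
Proof. by move=> pF; case: (proper_funP x pF) => // ->; rewrite ltxx. Qed.

(* Lower semicontinuity at one point of the domain bounds [F] on a ball, and
   convexity propagates the bound linearly. *)
Lemma Gamma0_lower_bound F : Gamma0 F ->
  exists c b : R, 0 <= c /\ forall y, ((b - c * hnorm y)%:E <= F y)%E.
Proof.
move=> [pF lF cF]; case: (pF) => _ [x0 /(proper_fun_fin pF)[t0 Fx0]].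
have [|d d0 near_x0] := lF x0 (t0 - 1); first by rewrite Fx0 lte_fin gtrBl.
exists (2 / d), (t0 - 1 - 2 / d * hnorm x0); split.
  by rewrite divr_ge0 // ltW.
move=> y; have [->|[s Fy]] := proper_funP y pF; first by rewrite leey.
rewrite Fy lee_fin.
have yx0 := hnormB_le y x0; have d20 : 0 < 2 / d by rewrite divr_gt0.
have [yd|dy] := ltP (hnorm (y - x0)) d.
  have := near_x0 _ yd; rewrite Fy lte_fin.
  have := mulr_ge0 (ltW d20) (hnorm_ge0 y).
  have := mulr_ge0 (ltW d20) (hnorm_ge0 x0); lra.
have N0 : 0 < hnorm (y - x0) by apply: lt_le_trans dy.
set N := hnorm (y - x0) in dy N0 yx0.
(* This weight puts the convex combination at distance [d / 2] from [x0], inside the ball where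
   [F > t0 - 1]. Dividing the loss of 1 by [a] gives [2 / d * N], hence the slope [2 / d]. *)
pose a := d / 2 / N.
have a01 : 0 < a < 1.
  rewrite /a !divr_gt0 // ltr_pdivrMr // mul1r; lra.
have := cF a y x0 a01; have := near_x0 (a *: y + (1 - a) *: x0).
have -> : a *: y + (1 - a) *: x0 - x0 = a *: (y - x0).
  by rewrite scalerBl scale1r scalerBr -!addrA; congr (_ + _); rewrite addrC subrK.
case/andP: (a01) => a0 _.
have -> : hnorm (a *: (y - x0)) = d / 2.
  by rewrite hnormZ gtr0_norm // -/N /a divfK ?gt_eqF.
rewrite ltr_pdivrMr // ltr_pMr // ltr1n => /(_ isT).
rewrite Fy Fx0 -!EFinM -EFinD => /lt_le_trans h /h; rewrite lte_fin => {}h.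
have aN : a * (2 / d * N) = 1.
  by rewrite /a; field; rewrite ?gt_eqF.
have {h} : a * (t0 - 1 - 2 / d * N) < a * s by lra.
rewrite ltr_pM2l // => h1.
have : 2 / d * N <= 2 / d * (hnorm y + hnorm x0) by rewrite ler_pM2l.
lra.
Qed.

Lemma prox_exists F x : Gamma0 F -> exists p, is_prox F x p.
Proof.
move=> gF; have [c [b [c0 Flow]]] := Gamma0_lower_bound gF.
case: gF => pF lF cF.
pose q y : R := hnorm (x - y) ^+ 2 / 2.
pose S := [set t : R | exists y s, F y = s%:E /\ t = s + q y].
(* With [t = hnorm (x - y)], the linear bound on [F] costs [c * t], and [t ^+ 2 / 2 - c * t] is at
   least [- c ^+ 2 / 2]. *)
have S_lb : lbound S (b - c * hnorm x - c ^+ 2 / 2).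
  move=> _ [y [s [Fy ->]]]; have := Flow y; rewrite Fy lee_fin /q => h.
  have : hnorm y <= hnorm x + hnorm (x - y).
    by have := hnormB_le x (x - y); rewrite subKr.
  move=> /(ler_wpM2l c0); have := sqr_ge0 (hnorm (x - y) - c); lra.
have S_inf : has_inf S.
  split; last by exists (b - c * hnorm x - c ^+ 2 / 2).
  by case: (pF) => _ [y /(proper_fun_fin pF)[s Fy]]; exists (s + q y), y, s.
set m := inf S.
have m_le y s : F y = s%:E -> m <= s + q y.
  by move=> Fy; apply: ge_inf; [case: S_inf|exists y, s].
have /choice[u uP] : forall n : nat, exists y, exists2 s,
    F y = s%:E & s + q y < m + n.+1%:R^-1.
  move=> n; have [||t [y [s [Fy ->]]] ?] := @inf_adherent _ S n.+1%:R^-1 => //.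
  by exists y; exists s.
(* The objective is at least [m] at the midpoint of [u n] and [u k], while convexity bounds it by
   the mean of the two values minus [hnorm (u n - u k) ^+ 2 / 8]. *)
have u_cauchy n k :
    hnorm (u n - u k) ^+ 2 <= 4 * (n.+1%:R^-1 + k.+1%:R^-1).
  have [s Fs hs] := uP n; have [s' Fs' hs'] := uP k.
  have h2 : 0 < (2^-1 : R) < 1 by rewrite invr_gt0 invf_lt1 // ltr1n ltr0n.
  have := cF _ (u n) (u k) h2; rewrite Fs Fs' -!EFinM -EFinD => mid.
  have [t Ft] := proper_fun_fin pF (le_lt_trans mid (ltry _)).
  have := m_le _ _ Ft; move: mid; rewrite Ft lee_fin.
  have qmid : q (2^-1 *: u n + (1 - 2^-1) *: u k) =
      2^-1 * q (u n) + (1 - 2^-1) * q (u k) - hnorm (u n - u k) ^+ 2 / 8.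
    rewrite /q.
    have -> : x - (2^-1 *: u n + (1 - 2^-1) *: u k) =
        2^-1 *: (x - u n) + (1 - 2^-1) *: (x - u k).
      rewrite !scalerBr addrACA -scalerDl addrC -opprD.
      by rewrite (addrC (2^-1)) subrK scale1r addrC.
    rewrite hnorm_sq_convex.
    have -> : x - u n - (x - u k) = u k - u n.
      by rewrite opprB addrC addrA subrK.
    by rewrite (hdistC (u k)); field.
  rewrite qmid; move: (q (u n)) (q (u k)) (n.+1%:R^-1) (k.+1%:R^-1) hs hs'.
  by clear; move: m => m0 *; lra.
have [|p up] := @hcomplete _ _ u.
  move=> e e0; have e80 : 0 < e ^+ 2 / 8 by rewrite divr_gt0 // exprn_gt0.
  have [N _ NP] := near_infty_natSinv_lt (PosNum e80).
  exists N => n k Nn Nk.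
  rewrite -(ltr_pXn2r (_ : 0 < 2)%N) ?nnegrE ?hnorm_ge0 ?ltW //.
  have := u_cauchy n k; have := NP _ Nn; have := NP _ Nk; rewrite /=.
  by move: (n.+1%:R^-1) (k.+1%:R^-1) => *; lra.
have qu : (fun n => q (u n)) @ \oo --> q p.
  by have h := strong_cvg_hdist (x := x) up; apply: cvgMr_tmp; apply: (cvgM h h).
exists p => y.
have Fp : (F p <= (m - q p)%:E)%E.
  rewrite leNgt; apply/negP => lt.
  (* Semicontinuity keeps [F (u n)] above such a real [t], whereas the minimising property bounds it
     by a sequence tending to [m - q p]. *)
  have [t mt tF] : exists2 t, m - q p < t & (t%:E < F p)%E.
    move: lt; have [->|[s ->]] := proper_funP p pF => lt.
      by exists (m - q p + 1); rewrite ?ltrDl ?ltry.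
    by rewrite lte_fin in lt; exists (((m - q p) + s) / 2); rewrite ?lte_fin; lra.
  have [d d0 dP] := lF _ _ tF.
  suff : t <= m + 0 - q p by lra.
  have hlim : (fun n => m + n.+1%:R^-1 - q (u n)) @ \oo --> m + 0 - q p.
    by apply: cvgB qu; apply: cvgD; [exact: cvg_cst|exact: cvg_harmonic].
  apply: (cvgr_to_ge hlim); near=> n.
  have [s Fu su] := uP n.
  have : (t%:E < F (u n))%E.
    apply: dP; near: n.
    exact: strong_cvg_near up d0.
  by rewrite Fu lte_fin; move: (q (u n)) (n.+1%:R^-1) su => *; lra.
have [->|[s Fy]] := proper_funP y pF; first by rewrite addye ?leey.
rewrite Fy; apply: (le_trans (leeD2r _ Fp)); rewrite -!EFinD lee_fin.
have := m_le _ _ Fy; rewrite /q; lra.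
Unshelve. all: by end_near.
Qed.

(** Comparing [p] with [a *: y + (1 - a) *: p] changes the quadratic term by
    [- a * inner (y - p) (x - p)] up to order [a ^+ 2]; divide by [a] and let it tend to 0. *)
Lemma is_prox_variational F x p : proper_fun F -> convex_fun F ->
  is_prox F x p -> subdiff F p (x - p).
Proof.
move=> pF cF Fprox.
have [s Fp] : exists s, F p = s%:E.
  apply: (proper_fun_fin pF).
  case: (pF) => _ [y0 /(proper_fun_fin pF)[s Fy0]].
  have := Fprox y0; rewrite Fy0.
  by have [->|[t ->]] := proper_funP p pF; rewrite ?ltry // addye.
split=> [|y]; first by rewrite Fp ltry.
rewrite Fp; have [->|[t Fy]] := proper_funP y pF; first by rewrite leey.
rewrite Fy -EFinD lee_fin; apply: (@ler_addM_small _ _ _ (hnorm (y - p) ^+ 2 / 2)).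
move=> a a01; have := cF a y p a01; have := Fprox (a *: y + (1 - a) *: p).
rewrite Fp Fy -!EFinM -EFinD => h1 h2.
have := le_trans h1 (leeD2r _ h2); rewrite -!EFinD lee_fin.
have -> : x - (a *: y + (1 - a) *: p) = (x - p) - a *: (y - p).
  by rewrite scalerBl scale1r scalerBr !opprD !opprK [RHS]addrAC (addrC (- p)) !addrA.
rewrite (hnormB_sq (x - p)) innerZr hnormZ (innerC (x - p)).
case/andP: a01 => a0 _; rewrite gtr0_norm // => h.
rewrite -(ler_pM2l a0); lra.
Qed.

Lemma Gamma0_fscale F (c : R) : 0 < c -> Gamma0 F -> Gamma0 (fscale c F).
Proof.
move=> c0 [pF lF cF].
have scaleE x s : F x = s%:E -> fscale c F x = (c * s)%:E.
  by move=> Fx; rewrite /fscale Fx EFinM.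
have scaley x : F x = +oo%E -> fscale c F x = +oo%E.
  by move=> Fx; rewrite /fscale Fx gt0_muley ?lte_fin.
split.
- split=> [x|].
    have [/scaley ->|[s /scaleE ->]] := proper_funP x pF; exact: ltNyr || done.
  by case: (pF) => _ [x /(proper_fun_fin pF)[s /scaleE Fx]]; exists x; rewrite Fx ltry.
- move=> x t tF.
  have [|d d0 dP] := lF x (t / c).
    move: tF; have [Fx|[s Fx]] := proper_funP x pF.
      by rewrite Fx ltry.
    by rewrite (scaleE _ _ Fx) Fx !lte_fin ltr_pdivrMr // mulrC.
  exists d => // y /dP; have [Fy|[s Fy]] := proper_funP y pF.
    by rewrite (scaley _ Fy) ltry.
  by rewrite (scaleE _ _ Fy) Fy !lte_fin ltr_pdivrMr // mulrC.
- move=> a x y a01; have := cF a x y a01.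
  rewrite /fscale -(@lee_pmul2l _ c%:E) ?lte_fin // => /le_trans; apply.
  case/andP: (a01) => a0 a1; have a1' : 0 < 1 - a by rewrite subr_gt0.
  have [Fx|[s Fx]] := proper_funP x pF; have [Fy|[t Fy]] := proper_funP y pF.
  + by rewrite Fx Fy; do !rewrite gt0_muley ?lte_fin //=.
  + by rewrite Fx Fy; do !rewrite gt0_muley ?lte_fin //=.
  + by rewrite Fx Fy; do !rewrite gt0_muley ?lte_fin //=.
  + by rewrite Fx Fy -?(EFinM,EFinD) lee_fin; lra.
Qed.

(** Existence gives the epsilon term [prox] its meaning. Dividing the optimality condition by [c]
    identifies it as the resolvent of the subdifferential with parameter [c]. *)
Lemma prox_subdiff F (c : R) x : 0 < c -> Gamma0 F ->
  subdiff F (prox (fscale c F) x) (c^-1 *: (x - prox (fscale c F) x)).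
Proof.
move=> c0 gF; have gcF := Gamma0_fscale c0 gF.
have := epsilon_spec (inhabits 0) _ (prox_exists x gcF).
rewrite -/(prox _ x); set p := prox _ x => /is_prox_variational.
case: (gcF) => pcF _ ccF => /(_ pcF ccF)[Fp Fsub].
case: (gF) => pF _ _.
have [s Fps] : exists s, F p = s%:E.
  have [e|//] := proper_funP p pF.
  by move: Fp; rewrite /fscale e gt0_muley ?lte_fin.
split=> [|y]; first by rewrite Fps ltry.
have [->|[t Fy]] := proper_funP y pF; first by rewrite leey.
have := Fsub y; rewrite /fscale Fps Fy -!EFinM -!EFinD !lee_fin innerZr => h.
by rewrite -(ler_pM2l c0) mulrDr mulrA divff ?gt_eqF // mul1r.
Qed.

End Prox.

(** * Riesz representation, weak limits along ultrafilters, Opial's lemma *)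

Section WeakLimits.
Variables (R : realType) (H : hilbert R).

(* The representing vector is a proximal point of [- phi]. *)
Lemma riesz (phi : H -> R) (c : R) :
  (forall a x y, phi (a *: x + y) = a * phi x + phi y) ->
  (forall x, `|phi x| <= c * hnorm x) ->
  exists p, forall y, phi y = inner p y.
Proof.
move=> lin bnd; pose F := fun y : H => (- phi y)%:E.
have pD x y : phi (x + y) = phi x + phi y by rewrite -[x]scale1r lin mul1r scale1r.
have p0 : phi 0 = 0 by apply: (addrI (phi 0)); rewrite -pD !addr0.
have pZ a x : phi (a *: x) = a * phi x by rewrite -[a *: x]addr0 lin p0 addr0.
have pN x : phi (- x) = - phi x by rewrite -scaleN1r pZ mulN1r.
have pF : proper_fun F by split=> [x|]; [rewrite ltNyr|exists 0; rewrite ltry].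
have cF : convex_fun F.
  by move=> a x y _; rewrite /F lin pZ -!EFinM -EFinD lee_fin; lra.
have lF : lsc F.
  move=> x t; rewrite lte_fin => tx.
  have c1 : 0 < `|c| + 1 by rewrite ltr_wpDl.
  exists ((- phi x - t) / (`|c| + 1)); first by rewrite divr_gt0 ?subr_gt0.
  move=> y; rewrite ltr_pdivlMr // lte_fin => yx.
  have := bnd (y - x); rewrite pD pN ler_norml => /andP[_ h].
  have := ler_wpM2r (hnorm_ge0 (y - x)) (ler_norm c).
  have := hnorm_ge0 (y - x); lra.
have [p /(is_prox_variational pF cF)[_ Fp]] := prox_exists 0 (And3 pF lF cF).
exists p; suff le y : phi y <= inner p y.
  move=> y; apply/eqP; rewrite eq_le le /=.
  by have := le (- y); rewrite innerNr pN lerN2.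
have := Fp (y + p); rewrite addrK lee_fin pD sub0r innerNr innerC; lra.
Qed.

Lemma fmap_ultra (T U : Type) (f : T -> U) (F : set_system T) :
  UltraFilter F -> UltraFilter (f @ F).
Proof.
move=> FU; split; first exact: fmap_proper_filter.
move=> G GP sFG; apply/seteqP; split=> A; last exact: sFG.
have [//|FnAf GA] := in_ultra_setVsetC (f @^-1` A) FU.
case: (@filter_not_empty _ G _).
by rewrite -(setICr A); apply: filterI => //; exact: sFG.
Qed.

Definition wcvg_along (U : set_system nat) (u : nat -> H) (p : H) :=
  forall y, (fun n => inner (u n) y) @ U --> inner p y.

(** Each [inner (u n) y] stays in a compact interval, so it converges along an ultrafilter. The
    limit is linear and bounded in [y], hence represented by a vector. *)
Lemma bounded_wcvg_ultra (u : nat -> H) (c : R) (U : set_system nat) :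
  UltraFilter U -> (forall n, hnorm (u n) <= c) ->
  exists p, wcvg_along U u p.
Proof.
move=> UU bnd.
have bndi y n : `|inner (u n) y| <= c * hnorm y.
  by rewrite (le_trans (inner_abs_le _ _)) // ler_wpM2r // hnorm_ge0.
have /choice[phi phiP] : forall y, exists t : R,
    `|t| <= c * hnorm y /\ (fun n => inner (u n) y) @ U --> t.
  move=> y; have := @segment_compact R (- (c * hnorm y)) (c * hnorm y).
  rewrite compact_ultra => /(_ _ (fmap_ultra (fun n => inner (u n) y) UU)).
  case=> [|t [/= tI tU]].
    by apply: (@filterE _ U) => n /=; rewrite in_itv /= -ler_norml.
  by exists t; split; rewrite // ler_norml; move: tI; rewrite in_itv.
have [|y|p phiE] := @riesz phi c; last 1 first.
- by exists p => y; rewrite -phiE; case: (phiP y).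
- move=> a x y; have [_ hx] := phiP x; have [_ hy] := phiP y.
  have [_ hxy] := phiP (a *: x + y).
  apply: (cvg_unique _ hxy) => //.
  rewrite (_ : (fun n => _) = (fun n => a * inner (u n) x + inner (u n) y)).
    by apply: cvgD hy; apply: cvgM hx; exact: cvg_cst.
  by apply/funext => n; rewrite innerDr innerZr.
- by case: (phiP y).
Qed.

(** Opial's lemma, with ultrafilters finer than [\oo] in the role of subsequences: convergence of
    the distances to two cluster points lying in [Z] forces these to coincide. *)
Lemma opial (u : nat -> H) (Z : set H) : Z !=set0 ->
  (forall z, Z z -> cvg ((fun n => hnorm (u n - z)) @ \oo)) ->
  (forall U p, UltraFilter U -> \oo `<=` U -> wcvg_along U u p -> Z p) ->
  exists2 p, Z p & weak_cvg u p.
Proof.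
move=> [z0 Zz0] cvgZ clusterZ.
have [c bnd] : exists c, forall n, hnorm (u n) <= c.
  have [M [_ MP]] := cvg_seq_bounded (cvgZ _ Zz0).
  exists (M + 1 + hnorm z0) => n.
  have M1 : M < M + 1 by rewrite ltrDl.
  have /= := MP _ M1 n Logic.I.
  rewrite ger0_norm ?hnorm_ge0 // => h.
  by rewrite -{1}[u n](subrK z0) (le_trans (hnormD_le _ _)) // lerD2r h.
have [U [UU ooU]] := ultraFilterLemma (@eventually_filter).
have [p Up] := bounded_wcvg_ultra UU bnd.
have Zp := clusterZ _ _ UU ooU Up.
exists p => // y; apply: contrapT => ncvg.
have [e e0 nnear] : exists2 e : R, 0 < e &
    ~ \forall n \near \oo, `|inner p y - inner (u n) y| < e.
  apply: contrapT => h; apply: ncvg; apply/cvgrPdist_lt => e e0.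
  by apply: contrapT => h'; apply: h; exists e.
(* If convergence fails at [y], [B] meets every tail. An ultrafilter containing [B] and all tails
   then yields a cluster point [q] separated from [p] by [y]. *)
pose B := [set n | e <= `|inner p y - inner (u n) y|].
have BP : ProperFilter (within B \oo).
  apply: Build_ProperFilter_ex => A BA; apply: contrapT => nA; apply: nnear.
  move: BA; rewrite /within /=; apply: filterS => n /= nB.
  by rewrite ltNge; apply/negP => Bn; apply: nA; exists n; exact: nB.
have [V [VV BV]] := ultraFilterLemma BP.
have ooV : \oo `<=` V.
  by move=> A Ao; apply: BV; rewrite /within /=; apply: filterS Ao.
have [q Vq] := bounded_wcvg_ultra VV bnd.
have Zq := clusterZ _ _ VV ooV Vq.
have e_le : e <= `|inner p y - inner q y|.
  have := Vq y => hq.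
  have : (fun n => `|inner p y - inner (u n) y|) @ V --> `|inner p y - inner q y|.
    by apply: cvg_norm; apply: cvgB hq; exact: cvg_cst.
  move/cvgr_to_ge; apply; apply: BV; rewrite /within /=; exact: nearW.
suff pq : p = q by move: e_le; rewrite pq subrr normr0 leNgt e0.
(* |u n - q|^2 - |u n - p|^2 is an affine function of <u n, p - q>, so both
   ultrafilters see the same limit of <u n, p - q>. *)
have cvg_pq : cvg ((fun n => inner (u n) (p - q)) @ \oo).
  have hp := cvgZ _ Zp; have hq := cvgZ _ Zq.
  rewrite (_ : (fun n => _) = (fun n =>
      (hnorm (u n - q) * hnorm (u n - q) - hnorm (u n - p) * hnorm (u n - p)
       + (hnorm p ^+ 2 - hnorm q ^+ 2)) / 2)).
    apply: is_cvgM; last exact: is_cvg_cst.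
    by apply: is_cvgD; [apply: is_cvgB; apply: is_cvgM|exact: is_cvg_cst].
  by apply/funext => n; rewrite -!expr2 !hnormB_sq innerBr; field.
have e1 : inner p (p - q) = lim ((fun n => inner (u n) (p - q)) @ \oo).
  apply: (cvg_unique _ (Up (p - q))) => //; apply: cvg_trans cvg_pq; exact: cvg_app ooU.
have e2 : inner q (p - q) = lim ((fun n => inner (u n) (p - q)) @ \oo).
  apply: (cvg_unique _ (Vq (p - q))) => //; apply: cvg_trans cvg_pq; exact: cvg_app ooV.
apply/eqP; rewrite -subr_eq0; apply/eqP/inner_eq0.
by rewrite innerBl e1 e2 subrr.
Qed.

End WeakLimits.

(** * Tseng's method with summable errors *)

Section BoundedSeries.
Variable R : realType.
Implicit Types e c : nat -> R.

(** For nonnegative terms this is summability, in a form stable under sums, scaling and comparison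
    with finite-sum arguments only. *)
Definition bounded_series e := exists b : R, forall n, \sum_(k < n) e k <= b.

Lemma bounded_seriesD e1 e2 : bounded_series e1 -> bounded_series e2 ->
  bounded_series (fun n => e1 n + e2 n).
Proof.
move=> [b1 h1] [b2 h2]; exists (b1 + b2) => n.
by rewrite big_split lerD.
Qed.

Lemma bounded_seriesZ e (a : R) : 0 <= a -> bounded_series e ->
  bounded_series (fun n => a * e n).
Proof.
by move=> a0 [b h]; exists (a * b) => n; rewrite -mulr_sumr ler_wpM2l.
Qed.

Lemma bounded_series_le e1 e2 : (forall n, e1 n <= e2 n) ->
  bounded_series e2 -> bounded_series e1.
Proof.
by move=> le [b h]; exists b => n; rewrite (le_trans _ (h n)) // ler_sum.
Qed.

Lemma bounded_series_sum (I : finType) (e : I -> nat -> R) :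
  (forall i, bounded_series (e i)) ->
  bounded_series (fun n => \sum_i e i n).
Proof.
move=> /choice[b h]; exists (\sum_i b i) => n.
by rewrite exchange_big ler_sum.
Qed.

Lemma bounded_series_cvg e : (forall n, 0 <= e n) -> bounded_series e ->
  cvg ((fun n => \sum_(k < n) e k) @ \oo).
Proof.
move=> e0 [b h]; apply: nondecreasing_is_cvgn; last by exists b => _ [n _ <-].
by apply/nondecreasing_seqP => n; rewrite big_ord_recr lerDl.
Qed.

Lemma bounded_series_cvg0 e : (forall n, 0 <= e n) -> bounded_series e ->
  e @ \oo --> 0.
Proof.
move=> e0 be; have := bounded_series_cvg e0 be.
set t := fun n => _ => ct.
rewrite (_ : e = fun n => t n.+1 - t n); last first.
  by apply/funext => n; rewrite /t big_ord_recr /= addrC addrK.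
rewrite -(subrr (lim (t @ \oo))); apply: cvgB => //.
by rewrite (cvg_shiftS t).
Qed.

(* [c n - \sum_(k < n) e k] is nonincreasing and bounded below. *)
Lemma quasi_fejer c e : (forall n, 0 <= c n) -> (forall n, 0 <= e n) ->
  bounded_series e -> (forall n, c n.+1 <= c n + e n) -> cvg (c @ \oo).
Proof.
move=> c0 e0 be step; have ce := bounded_series_cvg e0 be.
set t := fun n => \sum_(k < n) e k in ce.
rewrite (_ : c = fun n => (c n - t n) + t n); last first.
  by apply/funext => n; rewrite subrK.
apply: is_cvgD => //; apply: nonincreasing_is_cvgn.
  apply/nonincreasing_seqP => n; rewrite /t big_ord_recr /=.
  by have := step n; lra.
case: be => b h; exists (- b) => _ [n _ <-].
by have := h n; have := c0 n; rewrite /t; lra.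
Qed.

Lemma approx_bounded_series (H : hilbert R) (a b : nat -> H) : approx a b ->
  bounded_series (fun n => hnorm (a n - b n)).
Proof.
rewrite /approx; set S := (X in (X < _)%E) => Sfin.
have S0 : (0 <= S)%E by apply: nneseries_ge0 => n _ _; rewrite lee_fin hnorm_ge0.
have SE : S = (fine S)%:E by rewrite fineK // ge0_fin_numE.
exists (fine S) => n; rewrite -lee_fin -SE -sumEFin.
rewrite -(big_mkord xpredT (fun k => (hnorm (a k - b k))%:E)).
by apply: nneseries_lim_ge => k _ _; rewrite lee_fin hnorm_ge0.
Qed.

Lemma sqr_cvg0 c : (forall n, 0 <= c n) -> (fun n => c n ^+ 2) @ \oo --> 0 ->
  c @ \oo --> 0.
Proof.
move=> c0 /cvgrPdist_lt h; apply/cvgrPdist_lt => d d0.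
have := h _ (exprn_gt0 2 d0); apply: filterS => n.
rewrite !sub0r !normrN ger0_norm ?sqr_ge0 // ger0_norm //.
by rewrite ltr_pXn2r ?nnegrE // ltW.
Qed.

End BoundedSeries.

(** * Weak convergence of the perturbed forward-backward-forward iteration *)

Section ForwardBackwardForward.
Variables (R : realType) (E : hilbert R) (A : E -> set E) (Q : E -> E).
Variables (beta eps : R) (gamma : nat -> R) (J : nat -> E -> E).
Hypothesis monA : forall x y a b, A x a -> A y b -> 0 <= inner (x - y) (a - b).
(** [J n] is defined on all of [E], so [Id + gamma n A] is surjective; this is how maximality of [A]
    is expressed. *)
Hypothesis resJ : forall n s, A (J n s) ((gamma n)^-1 *: (s - J n s)).
Hypothesis monQ : forall x y, 0 <= inner (x - y) (Q x - Q y).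
Hypothesis lipQ : lipschitz_with beta Q.
Hypothesis beta0 : 0 < beta.
Hypothesis eps01 : 0 < eps < 1.
Hypothesis gammaP : forall n, eps <= gamma n <= (1 - eps) / beta.

Let gamma0 n : 0 < gamma n.
Proof.
by case/andP: eps01 => e0 _; case/andP: (gammaP n) => + _; apply: lt_le_trans.
Qed.

Let gamma_beta n : gamma n * beta <= 1 - eps.
Proof. by case/andP: (gammaP n) => _; rewrite ler_pdivlMr. Qed.

(** Monotonicity gives firm nonexpansiveness, then Cauchy-Schwarz applies. It carries the error made
    in [s n] through the backward step. *)
Lemma resolvent_nonexpansive n s t : hnorm (J n s - J n t) <= hnorm (s - t).
Proof.
have := monA (resJ n s) (resJ n t); rewrite -scalerBr innerZr.
rewrite pmulr_rge0 ?invr_gt0 //.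
have -> : s - J n s - (t - J n t) = (s - t) - (J n s - J n t).
  by rewrite opprD addrACA -opprD.
rewrite innerBr -hnorm_sq subr_ge0 => h.
have := le_trans h (inner_le _ _).
have [->|N0] := eqVneq (hnorm (J n s - J n t)) 0; first by rewrite hnorm_ge0.
by rewrite expr2 ler_pM2l // lt_def N0 hnorm_ge0.
Qed.

(** Monotonicity of [A] and [Q] between [p] and [z] makes the pairing of [p - z] with
    [x - p - gamma n *: (Q x - Q p)] nonnegative. Expanding the square leaves [gamma n ^+ 2 * hnorm
    (Q x - Q p) ^+ 2 - hnorm (x - p) ^+ 2], and the Lipschitz bound absorbs the first term up to a
    factor [1 - eps]. *)
Lemma fbf_step n x z : A z (- Q z) ->
  let p := J n (x - gamma n *: Q x) in
  hnorm (p + gamma n *: (Q x - Q p) - z) ^+ 2 <=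
    hnorm (x - z) ^+ 2 - eps * hnorm (x - p) ^+ 2.
Proof.
move=> Az; set p := J n _; rewrite /=.
have := monA (resJ n (x - gamma n *: Q x)) Az; rewrite -/p opprK.
have := monQ p z; have g0 := gamma0 n.
set g := gamma n in g0 *; set a := Q x; set b := Q p; set c := Q z => monpz.
move=> /(mulr_ge0 (ltW g0)); rewrite innerDr innerZr mulrDr mulrA divff ?gt_eqF //.
have -> : x - g *: a - p = (x - p) - g *: a by rewrite addrAC.
rewrite mul1r innerBr innerZr => hA.
have lip : g ^+ 2 * hnorm (a - b) ^+ 2 <= (1 - eps) * hnorm (x - p) ^+ 2.
  have l1 : g * hnorm (a - b) <= (1 - eps) * hnorm (x - p).
    apply: (@le_trans _ _ (g * (beta * hnorm (x - p)))).
      by rewrite ler_pM2l // lipQ.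
    by rewrite mulrA ler_wpM2r ?hnorm_ge0 ?gamma_beta.
  have e0 : 0 <= 1 - eps by case/andP: eps01; lra.
  have gab0 := mulr_ge0 (ltW g0) (hnorm_ge0 (a - b)).
  have := ler_pM gab0 gab0 l1 l1.
  have : (1 - eps) * (1 - eps) * hnorm (x - p) ^+ 2 <= (1 - eps) * hnorm (x - p) ^+ 2.
    by rewrite ler_wpM2r ?sqr_ge0 // ler_piMl //; case/andP: eps01; lra.
  by lra.
have := monpz => /(mulr_ge0 (ltW g0)).
have -> : x - z = (x - p) + (p - z) by rewrite addrA subrK.
have -> : p + g *: (a - b) - z = (p - z) + g *: (a - b) by rewrite addrAC.
move: lip hA; rewrite !hnorm_sq.
move: (x - p) (p - z) => u w.
rewrite !(innerDl, innerDr, innerNl, innerNr, innerZl, innerZr).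
rewrite (innerC u w) (innerC a w) (innerC b w) (innerC b a); lra.
Qed.

(* Testing monotonicity at [q = J (p - gamma Q p)] forces [q = p], since
   [gamma * beta < 1]. *)
Lemma fbf_demiclosed (U : set_system nat) (u pt : nat -> E) (p : E) (c : R) :
  ProperFilter U -> (forall n, hnorm (pt n) <= c) -> wcvg_along U pt p ->
  (forall n, A (pt n) (u n - Q (pt n))) -> (fun n => hnorm (u n)) @ U --> 0 ->
  A p (- Q p).
Proof.
move=> UP bnd wp Ap u0.
have g0 := gamma0 0%N; have := resJ 0 (p - gamma 0%N *: Q p).
set g := gamma 0%N in g0 *; set q := J _ _; set a := g^-1 *: _ => Aq.
(* Monotonicity of [A + Q] between [pt n] and the fixed point [q]: the term with [u n] vanishes by
   boundedness, and the other has a fixed factor, so weak convergence suffices. *)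
have lim_ge : 0 <= 0 - inner (p - q) (a + Q q).
  have hlim : (fun n => (c + hnorm q) * hnorm (u n)
        - (inner (pt n) (a + Q q) - inner q (a + Q q)))
      @ U --> (c + hnorm q) * 0 - inner (p - q) (a + Q q).
    rewrite innerBl; apply: cvgB; first exact: cvgMl_tmp.
    by apply: cvgB; [exact: wp|exact: cvg_cst].
  rewrite mulr0 in hlim; apply: (cvgr_to_ge hlim); apply: nearW => n.
  have := monA (Ap n) Aq; have := monQ (pt n) q.
  have : inner (pt n - q) (u n) <= (c + hnorm q) * hnorm (u n).
    apply: (le_trans (inner_le _ _)); rewrite ler_wpM2r ?hnorm_ge0 //.
    by rewrite (le_trans (hnormB_le _ _)) // lerD2r.
  rewrite !(innerBl, innerBr, innerDr); lra.
(* Here [g *: (a + Q q)] equals [p - q - g *: (Q p - Q q)], so [hnorm (p - q) ^+ 2] is at most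
   [1 - eps] times itself. *)
have pq : p = q.
  apply/eqP; rewrite -subr_eq0; apply/eqP/hnorm_eq0; apply/eqP.
  rewrite -sqrf_eq0; apply/eqP/le_anti; rewrite sqr_ge0 andbT.
  have : g * inner (p - q) (Q p - Q q) <= (1 - eps) * hnorm (p - q) ^+ 2.
    apply: (@le_trans _ _ (g * (hnorm (p - q) * (beta * hnorm (p - q))))).
      rewrite ler_pM2l // (le_trans (inner_le _ _)) //.
      by rewrite ler_wpM2l ?hnorm_ge0 ?lipQ.
    have := gamma_beta 0; rewrite -/g => /(ler_wpM2r (sqr_ge0 (hnorm (p - q)))); lra.
  have : g * inner (p - q) (a + Q q) <= 0 by rewrite pmulr_rle0 // -oppr_ge0 -sub0r.
  rewrite (innerDr a) mulrDr /a innerZr mulrA divff ?gt_eqF // mul1r.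
  rewrite [p - _ - q]addrAC (innerBr (p - q)) innerZr -hnorm_sq => h1.
  rewrite innerBr => h2; case/andP: eps01 => e0 _.
  rewrite -(pmulr_rle0 _ e0); lra.
have -> : - Q p = a.
  by rewrite /a addrAC -pq subrr sub0r scalerN scalerA mulVf ?gt_eqF // scale1r.
by rewrite {1}pq.
Qed.

(** The last three conclusions serve strong convergence: [(pt n, a n)] are points of the graph of
    [A] produced by an exact backward step from [x n]. *)
Theorem fbf_weak_cvg (x s p q : nat -> E) :
  (exists z, A z (- Q z)) ->
  bounded_series (fun n => hnorm (s n - (x n - gamma n *: Q (x n)))) ->
  bounded_series (fun n => hnorm (p n - J n (s n))) ->
  bounded_series (fun n => hnorm (q n - (p n - gamma n *: Q (p n)))) ->
  (forall n, x n.+1 = x n - s n + q n) ->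
  exists X pt a, [/\ A X (- Q X), weak_cvg x X,
    (fun n => hnorm (x n - pt n)) @ \oo --> 0,
    forall n, A (pt n) (a n) &
    (fun n => inner (pt n - X) (a n + Q (pt n))) @ \oo --> 0].
Proof.
move=> Z0 hs hp hq xS.
pose st n := x n - gamma n *: Q (x n); pose pt n := J n (st n).
pose xt n := pt n + gamma n *: (Q (x n) - Q (pt n)).
(* The error in [p n] relative to [pt n] counts twice, directly and through [gamma n *: Q], whose
   Lipschitz constant is below 1; it is itself at most the error of [J] plus that of [s n], and the
   latter also counts once directly. *)
pose e n := 3 * hnorm (s n - st n) + 2 * hnorm (p n - J n (s n))
  + hnorm (q n - (p n - gamma n *: Q (p n))).
have e_ge0 n : 0 <= e n by rewrite !addr_ge0 ?mulr_ge0 ?hnorm_ge0.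
have be : bounded_series e.
  by apply: bounded_seriesD hq; apply: bounded_seriesD; apply: bounded_seriesZ.
have pert n : hnorm (x n.+1 - xt n) <= e n.
  have p_le : hnorm (p n - pt n) <= hnorm (p n - J n (s n)) + hnorm (s n - st n).
    apply: (le_trans (hdist_triangle _ (J n (s n)) _)).
    by rewrite lerD2l resolvent_nonexpansive.
  have -> : x n.+1 - xt n = - (s n - st n)
     + ((q n - (p n - gamma n *: Q (p n)))
        + ((p n - pt n) - gamma n *: (Q (p n) - Q (pt n)))).
    apply: inner_ext => y; rewrite xS /xt /st.
    by rewrite !(innerDr, innerNr, innerZr); ring.
  apply: (le_trans (hnormD_le _ _)); rewrite hnormN.
  apply: (le_trans (lerD (lexx _) (hnormD_le _ _))).
  apply: (le_trans (lerD (lexx _) (lerD (lexx _) (hnormB_le _ _)))).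
  have : hnorm (gamma n *: (Q (p n) - Q (pt n))) <= hnorm (p n - pt n).
    rewrite hnormZ gtr0_norm //;
    apply: (@le_trans _ _ (gamma n * (beta * hnorm (p n - pt n)))).
      by rewrite ler_pM2l // lipQ.
    rewrite mulrA ler_piMl ?hnorm_ge0 // (le_trans (gamma_beta n)) //.
    by case/andP: eps01; lra.
  by rewrite /e; lra.
have xt_le n z : A z (- Q z) -> hnorm (xt n - z) <= hnorm (x n - z).
  move=> Az; rewrite -(ler_pXn2r (_ : 0 < 2)%N) ?nnegrE ?hnorm_ge0 //.
  apply: (le_trans (fbf_step n (x n) Az)); rewrite gerBl mulr_ge0 ?sqr_ge0 //.
  by case/andP: eps01 => /ltW.
have cvgz z : A z (- Q z) -> cvg ((fun n => hnorm (x n - z)) @ \oo).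
  move=> Az; apply: (quasi_fejer (e := e)) => // n; first exact: hnorm_ge0.
  have := hdist_triangle (x n.+1) (xt n) z; have := pert n; have := xt_le n z Az; lra.
(* The distances of [x n] and [xt n] to [z] have the same limit, so the decrease
   [eps * hnorm (x n - pt n) ^+ 2] in [fbf_step] vanishes. *)
have xpt0 : (fun n => hnorm (x n - pt n)) @ \oo --> 0.
  case: Z0 => z Az; have := cvgz z Az.
  set t := fun n => hnorm (x n - z); set T := lim _ => tT.
  have txt : (fun n => hnorm (xt n - z)) @ \oo --> T.
    have e0 := bounded_series_cvg0 e_ge0 be.
    have tS : (fun n => t n.+1) @ \oo --> T by rewrite (cvg_shiftS t).
    apply: (@squeeze_cvgr _ _ _ _ (fun n => t n.+1 - e n) (fun n => t n.+1 + e n)).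
    - apply: nearW => n; rewrite /t; apply/andP; split.
        by have := hdist_triangle (x n.+1) (xt n) z; have := pert n; lra.
      have := hdist_triangle (xt n) (x n.+1) z; have := pert n.
      by rewrite (hdistC (x n.+1)); lra.
    - by rewrite -[X in _ --> X]subr0; apply: cvgB.
    - by rewrite -[X in _ --> X]addr0; apply: cvgD.
  apply: sqr_cvg0 => [n|]; first exact: hnorm_ge0.
  have e0 : 0 < eps by case/andP: eps01.
  apply: (@squeeze_cvgr _ _ _ _ (cst 0)
     (fun n => eps^-1 * (t n * t n - hnorm (xt n - z) * hnorm (xt n - z)))).
  - apply: nearW => n /=; rewrite sqr_ge0 /= mulrC ler_pdivlMr // -!expr2.
    by have := fbf_step n (x n) Az; rewrite -/(xt n) -/(pt n) /t; lra.
  - exact: cvg_cst.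
  - rewrite -[X in _ --> X](mulr0 eps^-1) -(subrr (T * T)).
    by apply: cvgMl_tmp; apply: cvgB; apply: cvgM.
pose a n := (gamma n)^-1 *: (st n - pt n).
have Aa n : A (pt n) (a n) by exact: resJ.
have au0 : (fun n => hnorm (a n + Q (pt n))) @ \oo --> 0.
  apply: (@squeeze_cvgr _ _ _ _ (cst 0) (fun n => (eps^-1 + beta) * hnorm (x n - pt n))).
  - apply: nearW => n /=; rewrite hnorm_ge0 /=.
    (* The lower bound [eps <= gamma n] controls the first term, the Lipschitz constant the
       second. *)
    have -> : a n + Q (pt n) = (gamma n)^-1 *: (x n - pt n) - (Q (x n) - Q (pt n)).
      rewrite /a /st addrAC scalerBr scalerA mulVf ?gt_eqF // scale1r.
      by rewrite opprB addrA addrAC.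
    apply: (le_trans (hnormB_le _ _)); rewrite mulrDl lerD ?lipQ //.
    rewrite hnormZ ler_wpM2r ?hnorm_ge0 // gtr0_norm ?invr_gt0 //.
    rewrite lef_pV2 ?posrE //; first by case/andP: (gammaP n).
    by case/andP: eps01.
  - exact: cvg_cst.
  - by rewrite -[X in _ --> X](mulr0 (eps^-1 + beta)); apply: cvgMl_tmp.
have pt_bnd z : A z (- Q z) -> exists c, forall n, hnorm (pt n - z) <= c.
  move=> Az; have cx := cvgz z Az; have cp : cvg ((fun n => hnorm (x n - pt n)) @ \oo).
    by apply: cvgP xpt0.
  have [M [_ MP]] := cvg_seq_bounded
    (is_cvgD cx cp : cvg ((fun n => hnorm (x n - z) + hnorm (x n - pt n)) @ \oo)).
  have M1 : M < M + 1 by rewrite ltrDl.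
  exists (M + 1) => n; have /= := MP _ M1 n Logic.I.
  rewrite ger0_norm ?addr_ge0 ?hnorm_ge0 // (hdistC (x n) (pt n)).
  by have := hdist_triangle (pt n) (x n) z; lra.
have [U w UU ooU Uw|X AX xX] := opial Z0 cvgz; first last.
- exists X, pt, a; split => //.
  have [c ptc] := pt_bnd _ AX.
  apply: (@squeeze_cvgr _ _ _ _ (fun n => - (c * hnorm (a n + Q (pt n))))
    (fun n => c * hnorm (a n + Q (pt n)))).
  + apply: nearW => n; rewrite -ler_norml (le_trans (inner_abs_le _ _)) //.
    by rewrite ler_wpM2r ?hnorm_ge0.
  + by rewrite -oppr0 -[X in - X](mulr0 c); apply: cvgN; apply: cvgMl_tmp.
  + by rewrite -[X in _ --> X](mulr0 c); apply: cvgMl_tmp.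
- case: Z0 => z0 Az0; have [c ptc] := pt_bnd _ Az0.
  apply: (@fbf_demiclosed U (fun n => a n + Q (pt n)) pt w (c + hnorm z0)).
  + move=> n; rewrite -{1}[pt n](subrK z0) (le_trans (hnormD_le _ _)) //.
    by rewrite lerD2r.
  + move=> y.
    rewrite (_ : (fun n => _) =
        (fun n => inner (x n) y - inner (x n - pt n) y)); last first.
      by apply/funext => n; rewrite innerBl subKr.
    rewrite -[X in _ --> X]subr0; apply: cvgB; first exact: Uw.
    apply: cvg_trans (cvg_app _ ooU) _.
    apply: (@squeeze_cvgr _ _ _ _ (fun n => - (hnorm y * hnorm (x n - pt n)))
       (fun n => hnorm y * hnorm (x n - pt n))).
    * by apply: nearW => n; rewrite -ler_norml mulrC inner_abs_le.
    * by rewrite -oppr0 -[X in - X](mulr0 (hnorm y)); apply: cvgN; apply: cvgMl_tmp.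
    * by rewrite -[X in _ --> X](mulr0 (hnorm y)); apply: cvgMl_tmp.
  + by move=> n; rewrite addrK.
  + by apply: cvg_trans au0; exact: cvg_app ooU.
Qed.

End ForwardBackwardForward.

(** * Products of Hilbert spaces *)

Section Product.
Variables (R : realType) (I : finType) (E : I -> hilbert R).

Definition hprod_fun : Type := forall i, E i.

HB.instance Definition _ := gen_eqMixin hprod_fun.
HB.instance Definition _ := gen_choiceMixin hprod_fun.

Fact hprod_addA : associative (fun X Y : hprod_fun => (fun i => X i + Y i) : hprod_fun).
Proof. by move=> X Y Z; apply: functional_extensionality_dep => i; rewrite addrA. Qed.
Fact hprod_addC : commutative (fun X Y : hprod_fun => (fun i => X i + Y i) : hprod_fun).
Proof. by move=> X Y; apply: functional_extensionality_dep => i; rewrite addrC. Qed.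
Fact hprod_add0 : left_id ((fun i => 0) : hprod_fun)
  (fun X Y : hprod_fun => (fun i => X i + Y i) : hprod_fun).
Proof. by move=> X; apply: functional_extensionality_dep => i; rewrite add0r. Qed.
Fact hprod_addN : left_inverse ((fun i => 0) : hprod_fun)
  (fun X : hprod_fun => (fun i => - X i) : hprod_fun)
  (fun X Y : hprod_fun => (fun i => X i + Y i) : hprod_fun).
Proof. by move=> X; apply: functional_extensionality_dep => i; rewrite addNr. Qed.

HB.instance Definition _ :=
  GRing.isZmodule.Build hprod_fun hprod_addA hprod_addC hprod_add0 hprod_addN.

Definition hprod_scale (a : R) (X : hprod_fun) : hprod_fun := fun i => a *: X i.

Fact hprod_scaleA a b X : hprod_scale a (hprod_scale b X) = hprod_scale (a * b) X.
Proof. by apply: functional_extensionality_dep => i; rewrite /hprod_scale scalerA. Qed.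
Fact hprod_scale1 : left_id 1 hprod_scale.
Proof. by move=> X; apply: functional_extensionality_dep => i; exact: scale1r. Qed.
Fact hprod_scaleDr : right_distributive hprod_scale +%R.
Proof. by move=> a X Y; apply: functional_extensionality_dep => i; exact: scalerDr. Qed.
Fact hprod_scaleDl X : {morph hprod_scale^~ X : a b / a + b}.
Proof. by move=> a b; apply: functional_extensionality_dep => i; exact: scalerDl. Qed.

HB.instance Definition _ := GRing.Zmodule_isLmodule.Build R hprod_fun
  hprod_scaleA hprod_scale1 hprod_scaleDr hprod_scaleDl.

Definition hprod_inner (X Y : hprod_fun) : R := \sum_i inner (X i) (Y i).

Fact hprod_innerP : is_inner_product hprod_inner.
Proof.
split=> [X Y|a X Y Z|X|X].
- by apply: eq_bigr => i _; rewrite innerC.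
- rewrite /hprod_inner mulr_sumr -big_split; apply: eq_bigr => i _ /=.
  by rewrite -innerZl -innerDl.
- by apply: sumr_ge0 => i _; exact: inner_ge0.
- move=> /eqP; rewrite psumr_eq0 => [|i _]; last exact: inner_ge0.
  move=> /allP X0; apply: functional_extensionality_dep => i.
  by apply/inner_eq0/eqP; apply: X0; rewrite mem_index_enum.
Qed.

Fact hprod_complete : ip_complete hprod_inner.
Proof.
move=> u uC.
have coord_le (X : hprod_fun) i : hnorm (X i) <= ip_norm hprod_inner X.
  rewrite ler_wsqrtr // /hprod_inner (bigD1 i) //= lerDl.
  by apply: sumr_ge0 => j _; exact: inner_ge0.
have ex i : exists l : E i, strong_cvg (fun n => u n i) l.
  apply: hcomplete => e /uC[N NP]; exists N => m n mN nN.
  exact: le_lt_trans (coord_le (u m - u n) i) (NP _ _ mN nN).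
pose l i := sval (cid (ex i)).
have lP i : strong_cvg (fun n => u n i) (l i) := svalP (cid (ex i)).
exists l; apply: sqr_cvg0 => [n|]; first exact: sqrtr_ge0.
rewrite (_ : (fun n => _) =
    fun n => \sum_i hnorm (u n i - l i) * hnorm (u n i - l i)).
  rewrite [X in _ --> X](_ : 0 = \sum_(i : I) 0 * 0); last first.
    by rewrite big1 // => i; rewrite mulr0.
  by apply: cvg_big => [|i _]; [exact: add_continuous|apply: cvgM; exact: lP].
apply/funext => n; rewrite sqr_sqrtr; last by case: hprod_innerP.
by apply: eq_bigr => i _; rewrite -expr2 hnorm_sq.
Qed.

Definition hprod : hilbert R := Hilbert hprod_innerP hprod_complete.

Definition hcoord (X : hprod) (i : I) : E i := X i.

Lemma hprod_ext (X Y : hprod) : (forall i, hcoord X i = hcoord Y i) -> X = Y.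
Proof. exact: functional_extensionality_dep. Qed.

Lemma hprod_innerE (X Y : hprod) :
  inner X Y = \sum_i inner (hcoord X i) (hcoord Y i).
Proof. by []. Qed.

Lemma hnorm_coord_le (X : hprod) i : hnorm (hcoord X i) <= hnorm X.
Proof.
rewrite ler_wsqrtr // hprod_innerE (bigD1 i) //= lerDl.
by apply: sumr_ge0 => j _; exact: inner_ge0.
Qed.

Lemma hnorm_le_sum (X : hprod) : hnorm X <= \sum_i hnorm (hcoord X i).
Proof.
rewrite -(ler_pXn2r (_ : 0 < 2)%N) ?nnegrE ?sumr_ge0 ?hnorm_ge0 //; last first.
  by move=> i _; exact: hnorm_ge0.
rewrite hnorm_sq hprod_innerE expr2 mulr_suml; apply: ler_sum => i _.
rewrite -hnorm_sq expr2 ler_wpM2l ?hnorm_ge0 // (bigD1 i) //= lerDl.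
by apply: sumr_ge0 => j _; exact: hnorm_ge0.
Qed.

Lemma hprod_bounded_series (a b : nat -> hprod) :
  (forall i, bounded_series (fun n => hnorm (hcoord (a n) i - hcoord (b n) i))) ->
  bounded_series (fun n => hnorm (a n - b n)).
Proof.
move=> /bounded_series_sum; apply: bounded_series_le => n; exact: hnorm_le_sum.
Qed.

Lemma weak_cvg_coord (u : nat -> hprod) (X : hprod) i :
  weak_cvg u X -> weak_cvg (fun n => hcoord (u n) i) (hcoord X i).
Proof.
move=> uX e; pose Y : hprod := eqtype.dfwith (fun j => 0 : E j) e.
have YE (Z : hprod) : inner Z Y = inner (hcoord Z i) e.
  rewrite hprod_innerE (bigD1 i) //= /hcoord /Y dfwith_in big1 ?addr0 // => j ji.
  by rewrite dfwith_out 1?eq_sym // inner0r.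
rewrite -YE (_ : (fun n => _) = fun n => inner (u n) Y); first exact: uX.
by apply/funext => n; rewrite YE.
Qed.

End Product.

(** * Cauchy-Schwarz inequalities for real sums *)

Section CauchySchwarz.
Variable R : realType.

Lemma cauchy_schwarz2 (a b c d : R) :
  a * c + b * d <= Num.sqrt (a ^+ 2 + b ^+ 2) * Num.sqrt (c ^+ 2 + d ^+ 2).
Proof.
rewrite -sqrtrM ?addr_ge0 ?sqr_ge0 // (le_trans (ler_norm _)) // -sqrtr_sqr.
by rewrite ler_wsqrtr //; have := sqr_ge0 (a * d - b * c); lra.
Qed.

Lemma cauchy_schwarz_sum (I : finType) (a b : I -> R) :
  \sum_i a i * b i <= Num.sqrt (\sum_i a i ^+ 2) * Num.sqrt (\sum_i b i ^+ 2).
Proof.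
elim: (index_enum I) => [|i s IH]; first by rewrite !big_nil sqrtr0 mul0r.
rewrite !big_cons; apply: (le_trans (lerD (lexx _) IH)).
have h c : Num.sqrt (\sum_(j <- s) c j ^+ 2) ^+ 2 = \sum_(j <- s) c j ^+ 2 :> R.
  by rewrite sqr_sqrtr // sumr_ge0 // => j _; exact: sqr_ge0.
by rewrite (le_trans (cauchy_schwarz2 _ _ _ _)) // !h.
Qed.

End CauchySchwarz.

(** * Subgradients, conjugates and uniform convexity *)

Section Convex.
Variables (R : realType) (H : hilbert R).
Implicit Types (F : H -> \bar R) (x y u : H).

Lemma subdiff_fin F x u : proper_fun F -> subdiff F x u -> exists s, F x = s%:E.
Proof. by move=> pF [Fx _]; exact: proper_fun_fin. Qed.

Lemma subdiff_le F x u s y : F x = s%:E -> subdiff F x u ->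
  ((s + inner (y - x) u)%:E <= F y)%E.
Proof. by move=> Fx [_ /(_ y)]; rewrite Fx -EFinD addrC. Qed.

Lemma subdiff_monotone F x y u v : (forall t, -oo < F t)%E ->
  subdiff F x u -> subdiff F y v -> 0 <= inner (x - y) (u - v).
Proof.
move=> pF dx dy; have Fpos t : (F t < +oo)%E -> exists s, F t = s%:E.
  by have := pF t; case: (F t) => // s _ _; exists s.
have [s Fx] := Fpos x dx.1; have [t Fy] := Fpos y dy.1.
have := subdiff_le y Fx dx; have := subdiff_le x Fy dy.
rewrite Fx Fy !lee_fin !(innerBl, innerBr); lra.
Qed.

Lemma fconj_ge F x u s : F x = s%:E -> ((inner x u - s)%:E <= fconj F u)%E.
Proof. by move=> Fx; apply: ereal_sup_ubound; exists x => //; rewrite Fx EFinB. Qed.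

(** The equality case of Fenchel-Young: the subgradient inequality says that [x] attains the
    supremum defining the conjugate. *)
Lemma fconj_subdiff F x u s : F x = s%:E -> subdiff F x u ->
  fconj F u = (inner x u - s)%:E.
Proof.
move=> Fx dF; apply/eqP; rewrite eq_le fconj_ge // andbT.
apply/ereal_supP => _ [y _ <-]; have := subdiff_le y Fx dF.
case: (F y) => [t| |] //=; last by rewrite leNye.
by rewrite -EFinB !lee_fin innerBl; lra.
Qed.

Lemma fconj_gtNy F u : proper_fun F -> (-oo < fconj F u)%E.
Proof.
move=> pF; case: (pF) => _ [x /(proper_fun_fin pF)[s /(@fconj_ge _ _ u)]].
by apply: lt_le_trans; rewrite ltNyr.
Qed.

Lemma subdiff_fconj F x u : proper_fun F -> subdiff F x u -> subdiff (fconj F) u x.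
Proof.
move=> pF dF; have [s Fx] := subdiff_fin pF dF.
split=> [|v]; rewrite (fconj_subdiff Fx dF) ?ltry // -EFinD.
apply: le_trans (fconj_ge v Fx); rewrite lee_fin !innerBl !(innerC x); lra.
Qed.

Lemma gradient_subdiff (l : H -> R) (gl : H -> H) x :
  convex_fun (fun u => (l u)%:E) -> is_gradient l gl ->
  subdiff (fun u => (l u)%:E) x (gl x).
Proof.
move=> cl dl; split=> [|y]; first exact: ltry.
rewrite -EFinD lee_fin; set d := y - x.
apply: (@ler_addM_small _ _ _ (hnorm d)) => e /andP[e0 _].
(* This [a] lies strictly between 0 and 1 and makes [a *: d] shorter than [t], also when [d = 0]. *)
have [t t0 tP] := dl x e e0; pose a := t / (hnorm d + 1 + t).
have n0 := hnorm_ge0 d; have p0 : 0 < hnorm d + 1 + t by lra.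
have a0 : 0 < a by rewrite divr_gt0.
have a1 : a < 1 by rewrite ltr_pdivrMr // mul1r; lra.
have := tP (a *: d); rewrite hnormZ gtr0_norm //.
have -> : a * hnorm d < t.
  rewrite /a mulrAC ltr_pdivrMr // ltr_pM2l //; lra.
move=> /(_ isT); rewrite ler_norml => /andP[h _]; move: h; rewrite innerZl.
have := cl a y x; rewrite a0 a1 => /(_ isT).
have -> : a *: y + (1 - a) *: x = x + a *: d.
  by rewrite scalerBl scale1r scalerBr addrC -addrA (addrC (- _)).
rewrite -!EFinM -EFinD lee_fin => h1 h2.
rewrite -(ler_pM2l a0); lra.
Qed.

(* The defining inequality of uniform convexity at the midpoint gives
   phi (|t n - x|) <= 2 <t n - x, u n - ub>. *)
Lemma unif_convex_strong F x ub (t u : nat -> H) (d : nat -> R) :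
  (forall y, -oo < F y)%E -> unif_convex_at F x -> subdiff F x ub ->
  (forall n, subdiff F (t n) (u n)) ->
  (forall n, inner (t n - x) (u n - ub) <= d n) -> d @ \oo --> 0 ->
  strong_cvg t x.
Proof.
move=> pF [Fx [phi [phi_mono phi_ge0 phi_eq0 _ phiP]]] dx dt d_ge d0.
have pF' : proper_fun F by split=> //; exists x.
have [s Fxs] := subdiff_fin pF' dx.
have phi_le n : (phi (hnorm (x - t n)) <= (2 * d n)%:E)%E.
  have [s' Fts] := subdiff_fin pF' (dt n).
  have h2 : 0 < (2^-1 : R) < 1 by rewrite invr_gt0 invf_lt1 // ltr1n ltr0n.
  have := phiP (t n) 2^-1; rewrite Fts ltry Fxs => /(_ isT h2).
  (* The subgradient at [x] bounds [F m] below and the one at [t n] bounds [F (t n)] above; a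
     quarter of [phi] is then at most half of [d n]. *)
  set m := _ + _ *: _; have := subdiff_le m Fxs dx.
  have : ((s' - inner (t n - x) (u n))%:E <= F x)%E.
    by rewrite -innerNl opprB; exact: subdiff_le.
  have -> : m - x = 2^-1 *: (t n - x).
    rewrite /m; apply: inner_ext => y.
    by rewrite !(innerDr, innerNr, innerZr); field.
  rewrite Fxs innerZl -!EFinM -!EFinD.
  have := d_ge n; rewrite innerBr.
  have := phi_ge0 _ (hnorm_ge0 (x - t n)); have := pF m.
  have q0 : 0 < 2^-1 * (1 - 2^-1) :> R by lra.
  case: (F m) => [b| |] // _; case: (phi _) => [c| |] // _ dn.
  - by rewrite -?(EFinM, EFinD) !lee_fin; lra.
  - by rewrite gt0_muley ?lte_fin // addey // leye_eq.
  - by rewrite gt0_muley ?lte_fin // addye // leye_eq.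
apply/cvgrPdist_lt => e e0.
have phie : (0 < phi e)%E.
  rewrite lt_def phi_ge0 ?ltW // andbT; apply/eqP => /(phi_eq0 _ (ltW e0)) ee.
  by rewrite ee ltxx in e0.
have [c c0 ce] : exists2 c, 0 < c & (c%:E <= phi e)%E.
  move: phie; case: (phi e) => [c| |] //; first by exists c.
  by exists 1; rewrite ?leey.
have c20 : 0 < c / 2 by rewrite divr_gt0.
move/cvgrPdist_lt: d0 => /(_ _ c20); apply: filterS => n.
rewrite !sub0r !normrN (ger0_norm (hnorm_ge0 _)) => dn.
rewrite ltNge; apply/negP; rewrite hdistC => /(phi_mono _ _ (ltW e0)) h.
have := le_trans (le_trans ce h) (phi_le n); rewrite lee_fin.
have := ler_norm (d n); lra.
Qed.

End Convex.

(** * The primal-dual inclusion *)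

Section PrimalDual.
Variables (R : realType) (H : hilbert R) (r : nat) (G K : 'I_r -> hilbert R).

(** One flat index for all blocks, so that the generic product supplies completeness and
    coordinatewise weak convergence at once. *)
Definition pd_index : finType := (unit + ('I_r + ('I_r + 'I_r)))%type.

Definition pd_family (i : pd_index) : hilbert R :=
  match i with
  | inl _ => H
  | inr (inl _) => H
  | inr (inr (inl k)) => G k
  | inr (inr (inr k)) => K k
  end.

Definition pd_space : hilbert R := hprod pd_family.

Definition pd_mk (x : H) (y : 'I_r -> H) (v : forall k, G k) (w : forall k, K k) :
    pd_space :=
  fun i => match i return pd_family i with
  | inl _ => x
  | inr (inl k) => y k
  | inr (inr (inl k)) => v k
  | inr (inr (inr k)) => w k
  end.

Definition pd_x (X : pd_space) : H := hcoord X (inl tt).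
Definition pd_y (X : pd_space) k : H := hcoord X (inr (inl k)).
Definition pd_v (X : pd_space) k : G k := hcoord X (inr (inr (inl k))).
Definition pd_w (X : pd_space) k : K k := hcoord X (inr (inr (inr k))).

Lemma pd_innerE (X Y : pd_space) : inner X Y = inner (pd_x X) (pd_x Y)
  + \sum_k (inner (pd_y X k) (pd_y Y k)
            + (inner (pd_v X k) (pd_v Y k) + inner (pd_w X k) (pd_w Y k))).
Proof.
rewrite hprod_innerE !big_sumType (big_pred1 tt) /=; last by case.
by congr (_ + _); rewrite -!big_split.
Qed.

Lemma pd_ext (X Y : pd_space) : pd_x X = pd_x Y -> (forall k, pd_y X k = pd_y Y k) ->
  (forall k, pd_v X k = pd_v Y k) -> (forall k, pd_w X k = pd_w Y k) -> X = Y.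
Proof.
move=> ex ey ev ew; apply: hprod_ext => -[[]|[k|[k|k]]].
- exact: ex.
- exact: ey.
- exact: ev.
- exact: ew.
Qed.

Lemma pd_bounded_series (a b : nat -> pd_space) :
  bounded_series (fun n => hnorm (pd_x (a n) - pd_x (b n))) ->
  (forall k, bounded_series (fun n => hnorm (pd_y (a n) k - pd_y (b n) k))) ->
  (forall k, bounded_series (fun n => hnorm (pd_v (a n) k - pd_v (b n) k))) ->
  (forall k, bounded_series (fun n => hnorm (pd_w (a n) k - pd_w (b n) k))) ->
  bounded_series (fun n => hnorm (a n - b n)).
Proof.
move=> hx hy hv hw; apply: hprod_bounded_series => -[[]|[k|[k|k]]].
- exact: hx.
- exact: hy.
- exact: hv.
- exact: hw.
Qed.

Variables (z : H) (f : H -> \bar R) (l : H -> R) (gl : H -> H).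
Variables (g : forall k, G k -> \bar R) (h : forall k, K k -> \bar R).
Variables (L : forall k, H -> G k) (Ls : forall k, G k -> H).
Variables (M : forall k, H -> K k) (Ms : forall k, K k -> H).
Arguments g : clear implicits.
Arguments h : clear implicits.
Arguments L : clear implicits.
Arguments Ls : clear implicits.
Arguments M : clear implicits.
Arguments Ms : clear implicits.
Hypothesis hf : Gamma0 f.
Hypothesis hg : forall k, Gamma0 (g k).
Hypothesis hh : forall k, Gamma0 (h k).
Hypothesis hlconv : convex_fun (fun u => (l u)%:E).
Hypothesis hgl : is_gradient l gl.
Hypothesis hL : forall k, bounded_linear (L k).
Hypothesis hLs : forall k, is_adjoint (L k) (Ls k).
Hypothesis hM : forall k, bounded_linear (M k).
Hypothesis hMs : forall k, is_adjoint (M k) (Ms k).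

(* [A] stands for (-z + df) x 0 x (dg_k)^-1 x (dh_k)^-1. *)
Definition pd_A (X : pd_space) : set pd_space := [set B |
  [/\ subdiff f (pd_x X) (pd_x B + z), forall k, pd_y B k = 0,
      forall k, subdiff (g k) (pd_v B k) (pd_v X k) &
      forall k, subdiff (h k) (pd_w B k) (pd_w X k)]].

Definition pd_Q (X : pd_space) : pd_space :=
  pd_mk (gl (pd_x X) + \sum_k Ls k (pd_v X k))
        (fun k => Ms k (pd_w X k) - Ls k (pd_v X k))
        (fun k => - L k (pd_x X - pd_y X k))
        (fun k => - M k (pd_y X k)).

(** The resolvent of [pd_A] with parameter [c]: the shift [c *: z] absorbs the [-z] of the first
    block, and the zero operator leaves the [y] block fixed. *)
Definition pd_J (c : R) (X : pd_space) : pd_space :=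
  pd_mk (prox (fscale c f) (pd_x X + c *: z)) (pd_y X)
    (fun k => pd_v X k - c *: prox (fscale c^-1 (g k)) (c^-1 *: pd_v X k))
    (fun k => pd_w X k - c *: prox (fscale c^-1 (h k)) (c^-1 *: pd_w X k)).

Let pf : forall t, (-oo < f t)%E. Proof. by case: hf => -[]. Qed.
Let pg k : forall t, (-oo < g k t)%E. Proof. by case: (hg k) => -[]. Qed.
Let ph k : forall t, (-oo < h k t)%E. Proof. by case: (hh k) => -[]. Qed.

(** Kept as an identity, so that a single summand can later be bounded by the whole pairing. *)
Lemma pd_A_inner (X Y a b : pd_space) : pd_A X a -> pd_A Y b ->
  inner (X - Y) (a - b) = inner (pd_x X - pd_x Y) (pd_x a - pd_x b)
    + \sum_k (inner (pd_v X k - pd_v Y k) (pd_v a k - pd_v b k)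
              + inner (pd_w X k - pd_w Y k) (pd_w a k - pd_w b k)).
Proof.
move=> [_ ya _ _] [_ yb _ _]; rewrite pd_innerE; congr (_ + _).
apply: eq_bigr => k _; rewrite [pd_y (a - b) k](_ : _ = pd_y a k - pd_y b k) //.
by rewrite ya yb subrr inner0r add0r.
Qed.

Lemma pd_A_x_ge0 (X Y a b : pd_space) : pd_A X a -> pd_A Y b ->
  0 <= inner (pd_x X - pd_x Y) (pd_x a - pd_x b).
Proof.
move=> [xa _ _ _] [xb _ _ _]; have := subdiff_monotone pf xa xb.
by rewrite opprD addrACA subrr addr0.
Qed.

Lemma pd_A_v_ge0 (X Y a b : pd_space) k : pd_A X a -> pd_A Y b ->
  0 <= inner (pd_v X k - pd_v Y k) (pd_v a k - pd_v b k).
Proof.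
move=> [_ _ va _] [_ _ vb _].
by rewrite innerC; exact: subdiff_monotone (@pg k) (va k) (vb k).
Qed.

Lemma pd_A_w_ge0 (X Y a b : pd_space) k : pd_A X a -> pd_A Y b ->
  0 <= inner (pd_w X k - pd_w Y k) (pd_w a k - pd_w b k).
Proof.
move=> [_ _ _ wa] [_ _ _ wb].
by rewrite innerC; exact: subdiff_monotone (@ph k) (wa k) (wb k).
Qed.

Lemma pd_A_monotone (X Y a b : pd_space) : pd_A X a -> pd_A Y b ->
  0 <= inner (X - Y) (a - b).
Proof.
move=> Xa Yb; rewrite (pd_A_inner Xa Yb) addr_ge0 ?pd_A_x_ge0 //.
by apply: sumr_ge0 => k _; rewrite addr_ge0 ?pd_A_v_ge0 ?pd_A_w_ge0.
Qed.

(* Moreau: s - c prox_{g/c} (s/c) is the resolvent of (dg)^-1 at s. *)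
Lemma pd_A_resolvent c X : 0 < c -> pd_A (pd_J c X) (c^-1 *: (X - pd_J c X)).
Proof.
move=> c0.
have resE (E : hilbert R) (s t : E) : c^-1 *: (s - (s - c *: t)) = t.
  by rewrite subKr scalerA mulVf ?gt_eqF // scale1r.
have moreau (E : hilbert R) (F : E -> \bar R) (s : E) : Gamma0 F ->
    let t := prox (fscale c^-1 F) (c^-1 *: s) in subdiff F t (s - c *: t).
  move=> gF t; have := @prox_subdiff _ _ F c^-1 (c^-1 *: s) _ gF.
  rewrite invr_gt0 -/t => /(_ c0).
  by rewrite invrK scalerBr scalerA divff ?gt_eqF // scale1r.
split.
- have := prox_subdiff (pd_x X + c *: z) c0 hf; congr subdiff.
  rewrite [pd_x (_ *: _)](_ : _ = c^-1 *: (pd_x X - pd_x (pd_J c X))) //.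
  rewrite addrAC [LHS]scalerDr scalerA mulVf ?gt_eqF // scale1r.
  by [].
- by move=> k; rewrite -[LHS]/(c^-1 *: (pd_y X k - pd_y X k)) subrr scaler0.
- move=> k; rewrite [pd_v (_ *: _) k](_ : _ =
    c^-1 *: (pd_v X k - (pd_v X k - c *: prox (fscale c^-1 (g k)) (c^-1 *: pd_v X k)))) //.
  by rewrite resE; exact: moreau.
- move=> k; rewrite [pd_w (_ *: _) k](_ : _ =
    c^-1 *: (pd_w X k - (pd_w X k - c *: prox (fscale c^-1 (h k)) (c^-1 *: pd_w X k)))) //.
  by rewrite resE; exact: moreau.
Qed.

(** With [Z = X - Y] the two sums cancel, which is skewness; with [Z = pd_Q X - pd_Q Y] the formula
    gives the Lipschitz bound. *)
Lemma pd_Q_inner (X Y Z : pd_space) (D := X - Y) : inner (pd_Q X - pd_Q Y) Z =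
  inner (gl (pd_x X) - gl (pd_x Y)) (pd_x Z)
  + \sum_k (inner (pd_v D k) (L k (pd_x Z - pd_y Z k))
            + inner (pd_w D k) (M k (pd_y Z k)))
  - \sum_k (inner (pd_v Z k) (L k (pd_x D - pd_y D k))
            + inner (pd_w Z k) (M k (pd_y D k))).
Proof.
have adjL k v x : inner (Ls k v) x = inner v (L k x) by rewrite innerC -hLs innerC.
have adjM k w x : inner (Ms k w) x = inner w (M k x) by rewrite innerC -hMs innerC.
rewrite pd_innerE.
rewrite [pd_x (_ - _)](_ : _ = (gl (pd_x X) - gl (pd_x Y)) +
    (\sum_k Ls k (pd_v X k) - \sum_k Ls k (pd_v Y k))); last by rewrite addrACA -opprD.
rewrite (innerDl _ _ (pd_x Z)) -!addrA; congr (_ + _).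
rewrite innerBl !inner_suml -!sumrB -big_split; apply: eq_bigr => k _ /=.
rewrite [pd_y (_ - _) k](_ : _ = (Ms k (pd_w X k) - Ls k (pd_v X k))
   - (Ms k (pd_w Y k) - Ls k (pd_v Y k))) //.
rewrite [pd_v (_ - _) k](_ : _ = - L k (pd_x X - pd_y X k) - - L k (pd_x Y - pd_y Y k)) //.
rewrite [pd_w (_ - _) k](_ : _ = - M k (pd_y X k) - - M k (pd_y Y k)) //.
rewrite [pd_v D k](_ : _ = pd_v X k - pd_v Y k) //.
rewrite [pd_w D k](_ : _ = pd_w X k - pd_w Y k) //.
rewrite [pd_x D](_ : _ = pd_x X - pd_x Y) //.
rewrite [pd_y D k](_ : _ = pd_y X k - pd_y Y k) //.
rewrite !(blinB (hL k)) !(blinB (hM k)).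
rewrite !(innerDl, innerDr, innerNl, innerNr) !adjL !adjM.
rewrite !(innerC (pd_v Z k)) !(innerC (pd_w Z k)); ring.
Qed.

Lemma pd_Q_inner_self (X Y : pd_space) : inner (X - Y) (pd_Q X - pd_Q Y) =
  inner (pd_x X - pd_x Y) (gl (pd_x X) - gl (pd_x Y)).
Proof. by rewrite innerC pd_Q_inner addrK innerC. Qed.

Lemma pd_gl_monotone x y : 0 <= inner (x - y) (gl x - gl y).
Proof.
apply: (subdiff_monotone (F := fun u => (l u)%:E)) => [t||]; first exact: ltNyr.
all: exact: gradient_subdiff.
Qed.

(** The part of [beta] beyond [mu]. It bounds the norm of the map sending [(x, y)] to the
    [L k (x - y k)] and [M k (y k)]: the sum comes from the shared [x], the maximum from the
    block-diagonal action on [y]. *)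
Definition pd_skew_norm : R := Num.sqrt (\sum_(k < r) opnorm (L k) ^+ 2
  + \big[Num.max/0]_(k < r) (opnorm (L k) ^+ 2 + opnorm (M k) ^+ 2)).

Definition pd_norm_xy (X : pd_space) : R :=
  Num.sqrt (hnorm (pd_x X) ^+ 2 + \sum_k hnorm (pd_y X k) ^+ 2).
Definition pd_norm_vw (X : pd_space) : R :=
  Num.sqrt (\sum_k (hnorm (pd_v X k) ^+ 2 + hnorm (pd_w X k) ^+ 2)).

Lemma pd_normE X : hnorm X = Num.sqrt (pd_norm_xy X ^+ 2 + pd_norm_vw X ^+ 2).
Proof.
have xy0 : 0 <= hnorm (pd_x X) ^+ 2 + \sum_k hnorm (pd_y X k) ^+ 2.
  by rewrite addr_ge0 ?sqr_ge0 // sumr_ge0 // => k _; exact: sqr_ge0.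
have vw0 : 0 <= \sum_k (hnorm (pd_v X k) ^+ 2 + hnorm (pd_w X k) ^+ 2).
  by rewrite sumr_ge0 // => k _; rewrite addr_ge0 ?sqr_ge0.
rewrite /pd_norm_xy /pd_norm_vw (sqr_sqrtr xy0) (sqr_sqrtr vw0).
rewrite -addrA -big_split /= hnorm_sq -[LHS]/(Num.sqrt (inner X X)) pd_innerE.
congr (Num.sqrt (_ + _)).
by apply: eq_bigr => k _; rewrite !hnorm_sq.
Qed.

Lemma pd_skew_le (X Y : pd_space) :
  `|\sum_k (inner (pd_v X k) (L k (pd_x Y - pd_y Y k))
            + inner (pd_w X k) (M k (pd_y Y k)))|
  <= pd_skew_norm * (pd_norm_xy Y * pd_norm_vw X).
Proof.
set a := fun k => opnorm (L k); set b := fun k => opnorm (M k).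
set v := fun k => hnorm (pd_v X k); set w := fun k => hnorm (pd_w X k).
set y := fun k => hnorm (pd_y Y k); set x := hnorm (pd_x Y).
have a0 k : 0 <= a k by apply: opnorm_ge0.
have b0 k : 0 <= b k by apply: opnorm_ge0.
set m := \big[Num.max/0]_(k < r) (a k ^+ 2 + b k ^+ 2).
have m_ge k : a k ^+ 2 + b k ^+ 2 <= m by exact: le_bigmax.
have m0 : 0 <= m by exact: bigmax_ge_id.
have vw_ge0 : 0 <= pd_norm_vw X by exact: sqrtr_ge0.
pose A := Num.sqrt (\sum_k a k ^+ 2); pose Yn := Num.sqrt (\sum_k y k ^+ 2).
have termx : \sum_k a k * v k <= A * pd_norm_vw X.
  apply: (le_trans (cauchy_schwarz_sum _ _)); rewrite ler_wpM2l ?sqrtr_ge0 //.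
  by rewrite ler_wsqrtr // ler_sum // => k _; rewrite lerDl sqr_ge0.
have termy : \sum_k (a k * v k + b k * w k) * y k <= Num.sqrt m * Yn * pd_norm_vw X.
  apply: (@le_trans _ _ (Num.sqrt m *
      \sum_k y k * Num.sqrt (v k ^+ 2 + w k ^+ 2))).
    rewrite mulr_sumr ler_sum // => k _; rewrite mulrA mulrAC ler_wpM2r ?hnorm_ge0 //.
    apply: (le_trans (cauchy_schwarz2 _ _ _ _)).
    by rewrite ler_wpM2r ?sqrtr_ge0 // ler_wsqrtr.
  rewrite -mulrA ler_wpM2l ?sqrtr_ge0 //.
  apply: (le_trans (cauchy_schwarz_sum _ _)); rewrite ler_wpM2l ?sqrtr_ge0 //.
  rewrite le_eqVlt; apply/orP; left; apply/eqP; congr Num.sqrt.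
  by apply: eq_bigr => k _; rewrite sqr_sqrtr ?addr_ge0 ?sqr_ge0.
apply: (@le_trans _ _ (x * \sum_k a k * v k + \sum_k (a k * v k + b k * w k) * y k)).
  apply: (le_trans (ler_norm_sum _ _ _)).
  rewrite mulr_sumr -big_split ler_sum // => k _ /=.
  apply: (le_trans (ler_normD _ _)).
  have hl : `|inner (pd_v X k) (L k (pd_x Y - pd_y Y k))| <= v k * (a k * (x + y k)).
    apply: (le_trans (inner_abs_le _ _)); rewrite ler_wpM2l ?hnorm_ge0 //.
    by rewrite (le_trans (opnormP (hL k) _)) // ler_wpM2l ?a0 ?hnormB_le.
  have hm : `|inner (pd_w X k) (M k (pd_y Y k))| <= w k * (b k * y k).
    apply: (le_trans (inner_abs_le _ _)); rewrite ler_wpM2l ?hnorm_ge0 //.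
    exact: opnormP (hM k) _.
  by move: hl hm; lra.
have := ler_wpM2l (hnorm_ge0 (pd_x Y)) termx; rewrite -/x => tx.
have xy : x * A + Yn * Num.sqrt m <= pd_norm_xy Y * pd_skew_norm.
  apply: (le_trans (cauchy_schwarz2 _ _ _ _)).
  have A2 : A ^+ 2 = \sum_k a k ^+ 2.
    by rewrite sqr_sqrtr // sumr_ge0 // => k _; exact: sqr_ge0.
  have Y2 : Yn ^+ 2 = \sum_k y k ^+ 2.
    by rewrite sqr_sqrtr // sumr_ge0 // => k _; exact: sqr_ge0.
  by rewrite A2 Y2 (sqr_sqrtr m0).
have := ler_wpM2r vw_ge0 xy; lra.
Qed.

Lemma pd_Q_lipschitz mu : 0 <= mu -> lipschitz_with mu gl ->
  lipschitz_with (mu + pd_skew_norm) pd_Q.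
Proof.
move=> mu0 lipl X Y; set D := X - Y; set N := pd_Q X - pd_Q Y.
have key Z : inner N Z <= (mu + pd_skew_norm) * hnorm D * hnorm Z.
  rewrite pd_Q_inner -/D.
  have t1 : inner (gl (pd_x X) - gl (pd_x Y)) (pd_x Z) <= mu * hnorm D * hnorm Z.
    apply: (le_trans (inner_le _ _)); apply: ler_pM; rewrite ?hnorm_ge0 //.
      apply: (le_trans (lipl _ _)); rewrite ler_wpM2l //.
      exact: (hnorm_coord_le D (inl tt)).
    exact: (hnorm_coord_le Z (inl tt)).
  have t2 := le_trans (ler_norm _) (pd_skew_le D Z).
  have := pd_skew_le Z D; rewrite -normrN => /(le_trans (ler_norm _)) t3.
  (* The skew part pairs the [xy] half of one vector with the [vw] half of the other; treating both
     products together by Cauchy-Schwarz avoids a factor 2. *)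
  have t4 : pd_skew_norm * (pd_norm_xy Z * pd_norm_vw D + pd_norm_xy D * pd_norm_vw Z)
      <= pd_skew_norm * (hnorm D * hnorm Z).
    rewrite ler_wpM2l ?sqrtr_ge0 // !pd_normE.
    rewrite (mulrC (pd_norm_xy Z)) addrC.
    apply: (le_trans (cauchy_schwarz2 _ _ _ _)).
    by rewrite (addrC (pd_norm_vw Z ^+ 2)).
  by move: t1 t2 t3 t4; lra.
have := key N; rewrite -hnorm_sq expr2.
have [->|N0] := eqVneq (hnorm N) 0.
  by rewrite mulr_ge0 ?hnorm_ge0 ?addr_ge0 ?sqrtr_ge0.
by rewrite ler_pM2r // lt_def N0 hnorm_ge0.
Qed.

Lemma pd_zeroP (X : pd_space) : pd_A X (- pd_Q X) <->
  [/\ subdiff f (pd_x X) (z - \sum_k Ls k (pd_v X k) - gl (pd_x X)),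
      forall k, Ms k (pd_w X k) = Ls k (pd_v X k),
      forall k, subdiff (g k) (L k (pd_x X - pd_y X k)) (pd_v X k) &
      forall k, subdiff (h k) (M k (pd_y X k)) (pd_w X k)].
Proof.
have ex : pd_x (- pd_Q X) + z = z - \sum_k Ls k (pd_v X k) - gl (pd_x X).
  by rewrite -[pd_x _]/(- (gl (pd_x X) + _)) addrC opprD addrA addrAC.
have ey k : pd_y (- pd_Q X) k = - (Ms k (pd_w X k) - Ls k (pd_v X k)) by [].
have ev k : pd_v (- pd_Q X) k = L k (pd_x X - pd_y X k) by rewrite -[RHS]opprK.
have ew k : pd_w (- pd_Q X) k = M k (pd_y X k) by rewrite -[RHS]opprK.
split=> [[hx hy hv hw]|[hx hy hv hw]]; split; rewrite ?ex // in hx *.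
- by move=> k; apply/eqP; rewrite -subr_eq0 -oppr_eq0 -ey hy.
- by move=> k; rewrite -ev.
- by move=> k; rewrite -ew.
- by move=> k; rewrite ey hy subrr oppr0.
- by move=> k; rewrite ev.
- by move=> k; rewrite ew.
Qed.

(** At [pd_x X] the splitting by [pd_y X k] bounds each infimal convolution above. At [u], every
    splitting is bounded below by subgradient inequalities whose slopes agree because
    [Ms k (pd_w X k) = Ls k (pd_v X k)], and all slopes add up to [z]. *)
Lemma pd_zero_primal (X : pd_space) : pd_A X (- pd_Q X) ->
  let P := fun u : H =>
    (f u + \sum_(k < r) infconv (fun t => g k (L k t)) (fun t => h k (M k t)) u
       + (l u)%:E - (inner u z)%:E)%E in
  forall u, (P (pd_x X) <= P u)%E.
Proof.
move=> /pd_zeroP; set x := pd_x X => -[hx hy hv hw] P u.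
have [s fx] : exists s, f x = s%:E by apply: subdiff_fin hx; case: hf.
have /choice[gs gE] : forall k, exists t, g k (L k (x - pd_y X k)) = t%:E.
  by move=> k; apply: subdiff_fin (hv k); case: (hg k).
have /choice[hs hE] : forall k, exists t, h k (M k (pd_y X k)) = t%:E.
  by move=> k; apply: subdiff_fin (hw k); case: (hh k).
apply: (@le_trans _ _ (s + \sum_k (gs k + hs k) + l x - inner x z)%:E).
  rewrite EFinB !EFinD /P fx leeB // leeD // leeD // -sumEFin lee_sum // => k _.
  by apply: ereal_inf_lbound; exists (pd_y X k) => //; rewrite gE hE.
apply: (@le_trans _ _ (((s + inner (u - x) (z - \sum_k Ls k (pd_v X k) - gl x))%:E
   + \sum_k (gs k + hs k + inner (u - x) (Ls k (pd_v X k)))%:E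
   + (l x + inner (u - x) (gl x))%:E - (inner u z)%:E)%E)).
  rewrite sumEFin -!EFinD lee_fin.
  have -> : \sum_k (gs k + hs k + inner (u - x) (Ls k (pd_v X k))) =
      \sum_k (gs k + hs k) + inner (u - x) (\sum_k Ls k (pd_v X k)).
    by rewrite inner_sumr big_split.
  by rewrite !innerBr (innerBl u x z); lra.
have ll := @subdiff_le _ _ (fun t => (l t)%:E) x (gl x) (l x) u erefl
  (gradient_subdiff x hlconv hgl).
apply: leeB => //; apply: leeD ll; apply: leeD; first exact: subdiff_le.
apply: lee_sum => k _.
apply/ereal_infP => _ [t _ <-].
apply: le_trans (leeD (subdiff_le _ (gE k) (hv k)) (subdiff_le _ (hE k) (hw k))).
rewrite -EFinD lee_fin -!(blinB (hL k)) -!(blinB (hM k)) hLs hMs hy !innerBl; lra.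
Qed.

(** Weak duality: both values are compared with minus the estimate of the primal value at [x].
    Fenchel-Young equality at the witnesses [gl x] and [pd_w X k] bounds [D (pd_v X)] above, and the
    inequality bounds [D vv] below. *)
Lemma pd_zero_dual (X : pd_space) : pd_A X (- pd_Q X) ->
  let D := fun vv : (forall k, G k) =>
    (infconv (fconj f) (fconj (fun t => (l t)%:E))
        (z - \sum_(k < r) Ls k (vv k))%R
     + \sum_(k < r) (fconj (g k) (vv k)
                     + infpost (Ms k) (fconj (h k)) (Ls k (vv k))))%E in
  forall vv, (D (pd_v X) <= D vv)%E.
Proof.
move=> /pd_zeroP; set x := pd_x X; set y := pd_y X => -[hx hy hv hw] D vv.
have [s fx] : exists s, f x = s%:E by apply: subdiff_fin hx; case: hf.
have /choice[gs gE] : forall k, exists t, g k (L k (x - y k)) = t%:E.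
  by move=> k; apply: subdiff_fin (hv k); case: (hg k).
have /choice[hs hE] : forall k, exists t, h k (M k (y k)) = t%:E.
  by move=> k; apply: subdiff_fin (hw k); case: (hh k).
have hl := gradient_subdiff x hlconv hgl.
apply: (@le_trans _ _ (inner x z - s - l x - \sum_k (gs k + hs k))%:E).
  apply: (@le_trans _ _ ((inner x (z - \sum_k Ls k (pd_v X k) - gl x) - s)%:E
      + (inner x (gl x) - l x)%:E
      + \sum_k (inner (L k (x - y k)) (pd_v X k) - gs k
                + (inner (M k (y k)) (pd_w X k) - hs k))%:E)%E).
    apply: leeD.
      apply: ereal_inf_lbound; exists (gl x) => //.
      rewrite (fconj_subdiff fx hx).
      by rewrite (@fconj_subdiff _ _ (fun t => (l t)%:E) x (gl x) (l x) erefl hl).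
    apply: lee_sum => k _; rewrite EFinD; apply: leeD.
      by rewrite (fconj_subdiff (gE k) (hv k)).
    apply: ereal_inf_lbound; exists (pd_w X k) => //.
    by rewrite (fconj_subdiff (hE k) (hw k)).
  have -> : (\sum_k (inner (L k (x - y k)) (pd_v X k) - gs k
      + (inner (M k (y k)) (pd_w X k) - hs k))%:E)%E =
      (inner x (\sum_k Ls k (pd_v X k)) - \sum_k (gs k + hs k))%:E.
    rewrite sumEFin inner_sumr -sumrB; congr EFin; apply: eq_bigr => k _.
    by rewrite hLs hMs hy innerBl; ring.
  by rewrite -!EFinD lee_fin !innerBr; lra.
apply: (@le_trans _ _ ((inner x (z - \sum_k Ls k (vv k)) - s - l x)%:E
    + \sum_k (inner (L k (x - y k)) (vv k) - gs k
              + (inner (y k) (Ls k (vv k)) - hs k))%:E)%E).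
  have -> : (\sum_k (inner (L k (x - y k)) (vv k) - gs k
      + (inner (y k) (Ls k (vv k)) - hs k))%:E)%E =
      (inner x (\sum_k Ls k (vv k)) - \sum_k (gs k + hs k))%:E.
    rewrite sumEFin inner_sumr -sumrB; congr EFin; apply: eq_bigr => k _.
    by rewrite hLs innerBl; ring.
  by rewrite -!EFinD lee_fin !innerBr; lra.
apply: leeD.
  apply/ereal_infP => _ [t _ <-].
  have lt_ge := @fconj_ge _ _ (fun t => (l t)%:E) x t (l x) erefl.
  apply: le_trans (leeD (fconj_ge _ fx) lt_ge).
  by rewrite -EFinD lee_fin !innerBr; lra.
apply: lee_sum => k _; rewrite EFinD; apply: leeD; first exact: fconj_ge.
apply/ereal_infP => _ [t /= <- <-].
by rewrite -hMs; exact: fconj_ge.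
Qed.

End PrimalDual.

Lemma big_op_addP (R : realType) (H : hilbert R) (I : eqType) (s : seq I)
    (A : I -> H -> set H) (x u : H) : uniq s ->
  (\big[@op_add R H/@op_zero R H]_(k <- s) A k) x u ->
  exists b : I -> H, (forall k, k \in s -> A k x (b k)) /\ u = \sum_(k <- s) b k.
Proof.
elim: s u => [|i s IH] u.
  by rewrite !big_nil => _ ->; exists (fun=> 0); rewrite big_nil.
rewrite big_cons => /= /andP[iNs us] [a Aa [c /(IH _ us)[b [bP ->]] <-]].
(* [uniq] guarantees that redefining the selection at [i] leaves the tail sum unchanged. *)
exists (fun k => if k == i then a else b k); split=> [k|].
  by rewrite inE; case: eqVneq => [->|] //= _; exact: bP.
rewrite big_cons eqxx; congr (_ + _); apply: eq_big_seq => k ks.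
by case: eqVneq => // ki; move: iNs; rewrite -ki ks.
Qed.

Lemma strong_cvg_close (R : realType) (H : hilbert R) (u t : nat -> H) x :
  (fun n => hnorm (u n - t n)) @ \oo --> 0 -> strong_cvg t x -> strong_cvg u x.
Proof.
move=> ut tx; apply: (@squeeze_cvgr _ _ _ _ (cst 0)
  (fun n => hnorm (u n - t n) + hnorm (t n - x))).
- by apply: nearW => n; rewrite hnorm_ge0 hdist_triangle.
- exact: cvg_cst.
- by rewrite -[X in _ --> X]addr0; apply: cvgD.
Qed.

Theorem theorem4p3 (R : realType) (H : hilbert R) (r : nat) (hr : (0 < r)%N)
  (z : H) (f : H -> \bar R) (hf : Gamma0 f)
  (l : H -> R) (gl : H -> H) (mu : R) (hmu : 0 <= mu)
  (hlconv : convex_fun (fun u => (l u)%:E)) (hgl : is_gradient l gl)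
  (hlip : lipschitz_with mu gl)
  (G K : 'I_r -> hilbert R)
  (g : forall k, G k -> \bar R) (h : forall k, K k -> \bar R)
  (hg : forall k, Gamma0 (g k)) (hh : forall k, Gamma0 (h k))
  (L : forall k, H -> G k) (Ls : forall k, G k -> H)
  (M : forall k, H -> K k) (Ms : forall k, K k -> H)
  (hL : forall k, bounded_linear (L k)) (hLs : forall k, is_adjoint (L k) (Ls k))
  (hM : forall k, bounded_linear (M k)) (hMs : forall k, is_adjoint (M k) (Ms k))
  (beta : R)
  (hbeta_def : beta = mu + Num.sqrt (\sum_(k < r) opnorm (L k) ^+ 2
        + \big[Num.max/0]_(k < r) (opnorm (L k) ^+ 2 + opnorm (M k) ^+ 2)))
  (hbeta : 0 < beta)
  (hsri1 : forall k, sri (set_sub (dom (fconj (fun u => g k (L k u))))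
                                 (Ms k @` dom (fconj (h k)))) 0)
  (hsri2 : forall k, sri (set_sub (range (M k)) (dom (h k))) 0)
  (hran : ran (op_add (op_add (subdiff f)
              (\big[@op_add R H/@op_zero R H]_(k < r)
                 op_parsum (op_comp (L k) (Ls k) (subdiff (g k)))
                           (op_comp (M k) (Ms k) (subdiff (h k)))))
            (op_single gl)) z)
  (eps : R) (heps : 0 < eps < 1 / (beta + 1))
  (gamma : nat -> R) (hgamma : forall n, eps <= gamma n <= (1 - eps) / beta)
  (x : nat -> H) (y : 'I_r -> nat -> H)
  (v : forall k, nat -> G k) (w : forall k, nat -> K k)
  (s11 p11 q11 : nat -> H) (p1 q1 : 'I_r -> nat -> H)
  (s2 p2 q2 : forall k, nat -> G k) (s2r p2r q2r : forall k, nat -> K k)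
  (hs11 : approx s11
     (fun n => x n - gamma n *: (gl (x n) + \sum_(k < r) Ls k (v k n))))
  (hp11 : approx p11 (fun n => prox (fscale (gamma n) f) (s11 n + gamma n *: z)))
  (hp1 : forall k, approx (p1 k)
     (fun n => y k n + gamma n *: (Ls k (v k n) - Ms k (w k n))))
  (hs2 : forall k, approx (s2 k)
     (fun n => v k n + gamma n *: L k (x n - y k n)))
  (hp2 : forall k, approx (p2 k)
     (fun n => s2 k n - gamma n *:
        prox (fscale (gamma n)^-1 (g k)) ((gamma n)^-1 *: s2 k n)))
  (hq2 : forall k, approx (q2 k)
     (fun n => p2 k n + gamma n *: L k (p11 n - p1 k n)))
  (hv : forall k n, v k n.+1 = v k n - s2 k n + q2 k n)
  (hs2r : forall k, approx (s2r k) (fun n => w k n + gamma n *: M k (y k n)))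
  (hp2r : forall k, approx (p2r k)
     (fun n => s2r k n - gamma n *:
        prox (fscale (gamma n)^-1 (h k)) ((gamma n)^-1 *: s2r k n)))
  (hq1 : forall k, approx (q1 k)
     (fun n => p1 k n + gamma n *: (Ls k (p2 k n) - Ms k (p2r k n))))
  (hq2r : forall k, approx (q2r k)
     (fun n => p2r k n + gamma n *: M k (p1 k n)))
  (hw : forall k n, w k n.+1 = w k n - s2r k n + q2r k n)
  (hq11 : approx q11
     (fun n => p11 n - gamma n *: (gl (p11 n) + \sum_(k < r) Ls k (p2 k n))))
  (hx : forall n, x n.+1 = x n - s11 n + q11 n)
  (hy : forall k n, y k n.+1 = y k n - p1 k n + q1 k n) :
  let P := fun u : H =>
    (f u + \sum_(k < r) infconv (fun t => g k (L k t)) (fun t => h k (M k t)) u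
       + (l u)%:E - (inner u z)%:E)%E in
  let D := fun vv : (forall k, G k) =>
    (infconv (fconj f) (fconj (fun t => (l t)%:E))
        (z - \sum_(k < r) Ls k (vv k))%R
     + \sum_(k < r) (fconj (g k) (vv k)
                     + infpost (Ms k) (fconj (h k)) (Ls k (vv k))))%E in
  exists (xb : H) (vb : forall k, G k),
    [/\ (forall u : H, (P xb <= P u)%E),
        (forall vv : (forall k, G k), (D vb <= D vv)%E),
        weak_cvg x xb /\ (forall k, weak_cvg (v k) (vb k)),
        (unif_convex_at f xb \/ unif_convex_at (fun t => (l t)%:E) xb) ->
          strong_cvg x xb &
        forall k, unif_convex_at (fconj (g k)) (vb k) -> strong_cvg (v k) (vb k)].
Proof.
move=> P D.
pose Q := pd_Q gl L Ls M Ms; pose A := pd_A z f g h.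
pose J n := pd_J z f g h (gamma n).
case/andP: (heps) => eps0 eps1.
have eps01 : 0 < eps < 1.
  by rewrite eps0 (lt_trans eps1) // ltr_pdivrMr ?mul1r ?addr_gt0 // ltrDr.
have gamma0 n : 0 < gamma n by case/andP: (hgamma n) => + _; apply: lt_le_trans.
have monA : forall X Y a b, A X a -> A Y b -> 0 <= inner (X - Y) (a - b).
  by move=> X Y a b; exact: pd_A_monotone.
have resJ n X : A (J n X) ((gamma n)^-1 *: (X - J n X)) by exact: pd_A_resolvent.
have monQ X Y : 0 <= inner (X - Y) (Q X - Q Y).
  by rewrite (pd_Q_inner_self gl hL hLs hM hMs) (pd_gl_monotone hlconv hgl).
have lipQ : lipschitz_with beta Q by rewrite hbeta_def; exact: pd_Q_lipschitz.
have A_zero : exists X, A X (- Q X).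
  (* Unfolding each parallel sum writes [x0] as [a1 + a2]; [a2] becomes [y_k], and the common value
     [c k] is both [Ls k v_k] and [Ms k w_k]. *)
  have [x0 [_ [a fa [b gb <-]] [_ -> zE]]] := hran.
  have [c [cP bE]] := big_op_addP (index_enum_uniq _) gb.
  have ex k : exists t : H * (G k * K k),
      [/\ subdiff (g k) (L k (x0 - t.1)) t.2.1, Ls k t.2.1 = c k,
          subdiff (h k) (M k t.1) t.2.2 & Ms k t.2.2 = c k].
    have [a1 [v1 gv1 v1c] [a2 [w2 hw2 w2c] aE]] := cP k (mem_index_enum k).
    by exists (a2, (v1, w2)); rewrite /= -aE addrK.
  pose t k := sval (cid (ex k)).
  have tP k := svalP (cid (ex k)).
  exists (pd_mk x0 (fun k => (t k).1) (fun k => (t k).2.1) (fun k => (t k).2.2)).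
  apply/pd_zeroP; split=> [|k|k|k].
  - rewrite [pd_x _](_ : _ = x0) // (eq_bigr c) => [|k _]; last by case: (tP k).
    by rewrite -zE bE addrAC addrK addrK.
  - by case: (tP k) => _ vc _ wc; rewrite [LHS]wc.
  - by case: (tP k).
  - by case: (tP k).
pose X n : pd_space H G K := pd_mk (x n) (y ^~ n) (v ^~ n) (w ^~ n).
(* [p1] fills the [y] block of both [s] and [p]: the resolvent there is the identity, so the
   backward step adds no error. *)
pose s n : pd_space H G K := pd_mk (s11 n) (p1 ^~ n) (s2 ^~ n) (s2r ^~ n).
pose p n : pd_space H G K := pd_mk (p11 n) (p1 ^~ n) (p2 ^~ n) (p2r ^~ n).
pose q n : pd_space H G K := pd_mk (q11 n) (q1 ^~ n) (q2 ^~ n) (q2r ^~ n).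
have sum0 (E : hilbert R) (e : nat -> E) : bounded_series (fun n => hnorm (e n - e n)).
  by exists 0 => n; rewrite big1 // => i _; rewrite subrr hnorm0.
have apx (E : hilbert R) (a b c : nat -> E) : approx a b -> (forall n, b n = c n) ->
    bounded_series (fun n => hnorm (a n - c n)).
  by move=> ab bc; rewrite -(funext bc); exact: approx_bounded_series.
have hs : bounded_series (fun n => hnorm (s n - (X n - gamma n *: Q (X n)))).
  apply: pd_bounded_series => [|k|k|k]; first exact: apx hs11 _.
  - apply: apx (hp1 k) _ => n.
    by rewrite -[RHS]/(_ - _ *: (_ - _)) -scalerN opprB.
  - apply: apx (hs2 k) _ => n.
    by rewrite -[RHS]/(_ - _ *: - _) scalerN opprK.
  - apply: apx (hs2r k) _ => n.
    by rewrite -[RHS]/(_ - _ *: - _) scalerN opprK.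
have hp : bounded_series (fun n => hnorm (p n - J n (s n))).
  apply: pd_bounded_series => [|k|k|k]; first exact: apx hp11 _.
  - exact: sum0.
  - exact: apx (hp2 k) _.
  - exact: apx (hp2r k) _.
have hq : bounded_series (fun n => hnorm (q n - (p n - gamma n *: Q (p n)))).
  apply: pd_bounded_series => [|k|k|k]; first exact: apx hq11 _.
  - apply: apx (hq1 k) _ => n.
    by rewrite -[RHS]/(_ - _ *: (_ - _)) -scalerN opprB.
  - apply: apx (hq2 k) _ => n.
    by rewrite -[RHS]/(_ - _ *: - _) scalerN opprK.
  - apply: apx (hq2r k) _ => n.
    by rewrite -[RHS]/(_ - _ *: - _) scalerN opprK.
have XS n : X n.+1 = X n - s n + q n.
  by apply: pd_ext => [|k|k|k]; [exact: hx|exact: hy|exact: hv|exact: hw].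
have [Xb [pt [a [AXb Xweak Xpt Aa D0]]]] :=
  fbf_weak_cvg monA resJ monQ lipQ hbeta eps01 hgamma A_zero hs hp hq XS.
have [xb_f _ xb_g _] := AXb.
have proper_f : forall t, (-oo < f t)%E by case: hf => -[].
have DE n : inner (pt n - Xb) (a n + Q (pt n)) =
    inner (pd_x (pt n) - pd_x Xb) (pd_x (a n) - pd_x (- Q Xb))
    + \sum_k (inner (pd_v (pt n) k - pd_v Xb k) (pd_v (a n) k - pd_v (- Q Xb) k)
              + inner (pd_w (pt n) k - pd_w Xb k) (pd_w (a n) k - pd_w (- Q Xb) k))
    + inner (pd_x (pt n) - pd_x Xb) (gl (pd_x (pt n)) - gl (pd_x Xb)).
  rewrite -(pd_Q_inner_self gl hL hLs hM hMs) -(pd_A_inner (Aa n) AXb) -innerDr.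
  by rewrite opprK addrACA subrr addr0.
have gl_ge0 n := pd_gl_monotone hlconv hgl (pd_x (pt n)) (pd_x Xb).
have x_ge0 n := pd_A_x_ge0 hf (Aa n) AXb.
have v_ge0 k n := pd_A_v_ge0 hg k (Aa n) AXb.
have w_ge0 k n := pd_A_w_ge0 hh k (Aa n) AXb.
have sum_ge0 (S : pred 'I_r) n : 0 <= \sum_(k | S k)
    (inner (pd_v (pt n) k - pd_v Xb k) (pd_v (a n) k - pd_v (- Q Xb) k)
     + inner (pd_w (pt n) k - pd_w Xb k) (pd_w (a n) k - pd_w (- Q Xb) k)).
  by apply: sumr_ge0 => k _; rewrite addr_ge0.
exists (pd_x Xb), (pd_v Xb); split.
- exact: (pd_zero_primal hf hg hh hlconv hgl hL hLs hM hMs AXb).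
- exact: (pd_zero_dual hf hg hh hlconv hgl hLs hMs AXb).
- split=> [|k]; first exact: (weak_cvg_coord (i := inl tt : pd_index r) Xweak).
  exact: (weak_cvg_coord (i := inr (inr (inl k)) : pd_index r) Xweak).
(* Subgradients are available at [pt n], so strong convergence is proved there and transferred to
   [x n]. *)
- have xpt : (fun n => hnorm (x n - pd_x (pt n))) @ \oo --> 0.
    apply: (@squeeze_cvgr _ _ _ _ (cst 0) (fun n => hnorm (X n - pt n)))
      => //; last exact: cvg_cst.
    apply: nearW => n; rewrite hnorm_ge0 /=.
    exact: (hnorm_coord_le (X n - pt n) (inl tt)).
  case=> uc; apply: (strong_cvg_close xpt).
  + apply: (unif_convex_strong (u := fun n => pd_x (a n) + z)
      proper_f uc xb_f _ _ D0) => n.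
      by case: (Aa n).
    rewrite DE opprD addrACA subrr addr0; have := gl_ge0 n; have := sum_ge0 xpredT n; lra.
  + apply: (unif_convex_strong (u := fun n => gl (pd_x (pt n)))
      _ uc _ _ _ D0) => [t||n|n].
    * exact: ltNyr.
    * exact: gradient_subdiff hlconv hgl.
    * exact: gradient_subdiff hlconv hgl.
    * rewrite DE; have := x_ge0 n; have := sum_ge0 xpredT n; lra.
- move=> k uc.
  have xpt : (fun n => hnorm (v k n - pd_v (pt n) k)) @ \oo --> 0.
    apply: (@squeeze_cvgr _ _ _ _ (cst 0) (fun n => hnorm (X n - pt n)))
      => //; last exact: cvg_cst.
    apply: nearW => n; rewrite hnorm_ge0 /=.
    exact: (hnorm_coord_le (X n - pt n) (inr (inr (inl k)))).
  have proper_g : proper_fun (g k) by case: (hg k).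
  apply: (strong_cvg_close xpt).
  (* In the [v] block, [pd_v (a n) k] is a subgradient of the conjugate of [g k] at
     [pd_v (pt n) k]. *)
  apply: (unif_convex_strong (u := fun n => pd_v (a n) k) _ uc _ _ _ D0) => [t||n|n].
  + exact: fconj_gtNy.
  + exact: subdiff_fconj proper_g (xb_g k).
  + by case: (Aa n) => _ _ ga _; exact: subdiff_fconj proper_g (ga k).
  + rewrite DE (bigD1 k) //=.
    have := sum_ge0 (predC1 k) n.
    have := gl_ge0 n; have := x_ge0 n; have := w_ge0 k n; lra.
Qed.
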